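(* Let $D$ be an integral domain and $\star$ a semistar operation on $D$ with $\widetilde{\star}\text{-}\dim(D)<\infty$. The following are equivalent: (1) $D$ is a $\widetilde{\star}$-quasi-Prüfer domain; (2) for every overring $T$ of $D$ and every semistar operation $\star'$ on $T$ such that $T$ is $(\star,\star')$-linked to $D$, every extension of domains $T\subseteq S$ and every semistar operation $\star''$ on $S$, the extension $T\subseteq S$ satisfies the $(\widetilde{\star'},\widetilde{\star''})$-dimension inequality formula.
   Context: For a domain $R$ with quotient field $L$, $\overline{\mathcal F}(R)$ is the set of nonzero $R$-submodules of $L$ and $f(R)$ the set of nonzero finitely generated fractional ideals. A semistar operation $\ast$ on $R$ is a map $\overline{\mathcal F}(R)\to\overline{\mathcal F}(R)$ with $(xE)^\ast=xE^\ast$ ($0\ne x\in L$), $E\subseteq F\Rightarrow E^\ast\subseteq F^\ast$, $E\subseteq E^\ast=(E^\ast)^\ast$. $E^{\ast_f}:=\bigcup\{F^\ast:F\in f(R),F\subseteq E\}$. A nonzero ideal $I$ is a quasi-$\ast$-ideal if $I^\ast\cap R=I$; quasi-$\ast$-primes and quasi-$\ast$-maximal ideals are the prime ones / maximal proper ones; sets $\operatorname{QSpec}^\ast(R)$, $\operatorname{QMax}^\ast(R)$. $E^{\widetilde\ast}:=\bigcap\{ER_M:M\in\operatorname{QMax}^{\ast_f}(R)\}$ ($=L$ if empty). $\ast$-$\operatorname{ht}(P)$: supremum of lengths of chains of quasi-$\ast$-primes from $(0)$ to $P$ ($\ast$-$\operatorname{ht}(0)=0$); $\widetilde\ast$-$\operatorname{ht}(P)=\operatorname{ht}(P)$;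 $\widetilde\ast$-$\dim(R)=\sup\{\operatorname{ht}P:P\in\operatorname{QSpec}^{\widetilde\ast}(R)\}$. $D$ is a domain with quotient field $K$ and $\star$ a semistar operation on $D$. An overring $T$ of $D$ ($D\subseteq T\subseteq K$) with a semistar operation $\star'$ on $T$ is $(\star,\star')$-linked to $D$ if for every nonzero finitely generated ideal $F$ of $D$, $F^\star=D^\star$ implies $(FT)^{\star'}=T^{\star'}$. $D$ is $\ast$-quasi-Prüfer if whenever $Q$ is a prime of $D[X]$ with $Q\subseteq P[X]$ for some $P\in\operatorname{QSpec}^\ast(D)$, then $Q=(Q\cap D)[X]$. For domains $T\subseteq S$ with semistar operations $\star_1$ on $T$, $\star_2$ on $S$, $T\subseteq S$ satisfies the $(\star_1,\star_2)$-dimension inequality formula if for every $Q\in\operatorname{QSpec}^{\star_2}(S)$ with $(Q\cap T)^{\star_1}\subsetneq T^{\star_1}$, $\star_2$-$\operatorname{ht}(Q)+\operatorname{tr.deg}_{\mathbb K(Q\cap T)}\mathbb K(Q)\le\star_1$-$\operatorname{ht}(Q\cap T)+\operatorname{tr.deg}_T(S)$, where $\mathbb K(\mathfrak p)$ is the residue field at $\mathfrak p$ and $\operatorname{tr.deg}_T(S)$ is the transcendence degree of the quotient field of $S$ over that of $T$. *)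

(* Defs.v *)
From HB Require Import structures.
From mathcomp Require Import all_boot all_order all_algebra.
From Stdlib Require Import ClassicalEpsilon.
Set Implicit Arguments. Unset Strict Implicit. Unset Printing Implicit Defensive.
Import Order.TTheory GRing.Theory Num.Theory.
Local Open Scope ring_scope.

(* ---------- extended naturals N ∪ {∞} : None = ∞ ---------- *)
Definition is_esup (P : nat -> Prop) (o : option nat) : Prop :=
  match o with
  | Some n => (forall m, P m -> (m <= n)%N) /\
              (forall k, (forall m, P m -> (m <= k)%N) -> (n <= k)%N)
  | None => forall k, exists m, P m /\ (k < m)%N
  end.
(* supremum in N ∪ {∞} (sup of the empty set is 0) *)
Definition esup (P : nat -> Prop) : option nat :=
  epsilon (inhabits None) (is_esup P).
Definition eadd (a b : option nat) : option nat :=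
  match a, b with Some x, Some y => Some (x + y)%N | _, _ => None end.
Definition ele (a b : option nat) : Prop :=
  match a, b with
  | _, None => True
  | None, Some _ => False
  | Some x, Some y => (x <= y)%N
  end.

Definition subset {T : Type} (E F : T -> Prop) := forall x, E x -> F x.
Definition seteq {T : Type} (E F : T -> Prop) := forall x, E x <-> F x.
Definition ssub {T : Type} (E F : T -> Prop) := subset E F /\ exists x, F x /\ ~ E x.
Definition zeroset {R : nzRingType} : R -> Prop := fun x => x = 0.

Definition is_subring (R : comNzRingType) (A : R -> Prop) :=
  A 0 /\ A 1 /\ (forall x y, A x -> A y -> A (x - y)) /\
  (forall x y, A x -> A y -> A (x * y)).
Definition is_ideal (R : comNzRingType) (A I : R -> Prop) :=
  subset I A /\ I 0 /\ (forall x y, I x -> I y -> I (x + y)) /\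
  (forall a x, A a -> I x -> I (a * x)).
Definition is_prime (R : comNzRingType) (A P : R -> Prop) :=
  is_ideal A P /\ ~ P 1 /\
  (forall a b, A a -> A b -> P (a * b) -> P a \/ P b).

Section FieldDefs.
Variable K : fieldType.
Implicit Types (A : K -> Prop) (E F : K -> Prop).

Definition is_domain A :=
  is_subring A /\ forall x : K, exists a b, A a /\ A b /\ b != 0 /\ x = a / b.

Definition gen A (G : K -> Prop) : K -> Prop :=
  fun y => exists (n : nat) (a g : 'I_n -> K),
    (forall i, A (a i) /\ G (g i)) /\ y = \sum_(i < n) a i * g i.

Definition submod A E :=
  (exists x, E x /\ x != 0) /\ E 0 /\ (forall x y, E x -> E y -> E (x + y)) /\
  (forall a x, A a -> E x -> E (a * x)).

Definition fgfrac A F :=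
  exists s : seq K, (exists2 x, x \in s & x != 0) /\ seteq F (gen A (fun x => x \in s)).

Definition scale (x : K) E : K -> Prop := fun y => exists e, E e /\ y = x * e.

Definition semistar A (st : (K -> Prop) -> (K -> Prop)) :=
  (forall E, submod A E -> submod A (st E)) /\
  (forall x E, x != 0 -> submod A E -> seteq (st (scale x E)) (scale x (st E))) /\
  (forall E F, submod A E -> submod A F -> subset E F -> subset (st E) (st F)) /\
  (forall E, submod A E -> subset E (st E) /\ seteq (st (st E)) (st E)).

Definition star_f A (st : (K -> Prop) -> (K -> Prop)) E : K -> Prop :=
  fun y => exists F, fgfrac A F /\ subset F E /\ st F y.

Definition qideal A st I :=
  is_ideal A I /\ (exists x, I x /\ x != 0) /\ seteq (fun y => st I y /\ A y) I.
Definition qprime A st P := qideal A st P /\ is_prime A P.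
Definition qmax A st M :=
  qideal A st M /\ ~ M 1 /\
  (forall J, qideal A st J -> ~ J 1 -> subset M J -> subset J M).

Definition locid A (P I : K -> Prop) : K -> Prop :=
  fun x => exists a b, I a /\ A b /\ ~ P b /\ x = a / b.
Definition loc A P : K -> Prop := locid A P A.

(* E^{\tilde *} = ∩ { E A_M : M ∈ QMax^{*_f}(A) }  (= K if empty) *)
Definition st_tilde A st E : K -> Prop :=
  fun y => forall M, qmax A (star_f A st) M -> locid A M E y.

Definition prime_chain A P n :=
  exists c : nat -> (K -> Prop), seteq (c 0%N) zeroset /\ seteq (c n) P /\
    (forall i, (i <= n)%N -> is_prime A (c i)) /\
    (forall i, (i < n)%N -> ssub (c i) (c i.+1)).
Definition qchain A st P n :=
  exists c : nat -> (K -> Prop), seteq (c 0%N) zeroset /\ seteq (c n) P /\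
    (forall i, (0 < i <= n)%N -> qprime A st (c i)) /\
    (forall i, (i < n)%N -> ssub (c i) (c i.+1)).

Definition ht A P := esup (prime_chain A P).
Definition st_ht A st P := esup (qchain A st P).
Definition st_dim A st := esup (fun n => exists P, qprime A st P /\ prime_chain A P n).

Definition polyin (I : K -> Prop) : {poly K} -> Prop := fun p => forall i, I p`_i.

Definition quasi_prufer A st :=
  forall Q : {poly K} -> Prop, is_prime (polyin A) Q ->
    (exists P, qprime A st P /\ subset Q (polyin P)) ->
    seteq Q (polyin (fun a => A a /\ Q a%:P)).

Definition overring A T := is_subring T /\ subset A T.
Definition linked A (st : (K -> Prop) -> (K -> Prop)) T (st' : (K -> Prop) -> (K -> Prop)) :=
  forall F, fgfrac A F -> subset F A -> seteq (st F) (st A) ->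
    seteq (st' (gen T F)) (st' T).
End FieldDefs.

(* value of the polynomial with coefficients c (exponents < d in each of the
   m variables), coefficients pushed along j, at the point y *)
Definition peval (K F : fieldType) (j : K -> F) (m d : nat)
  (c : {ffun 'I_m -> 'I_d} -> K) (y : 'I_m -> F) : F :=
  \sum_(e : {ffun 'I_m -> 'I_d}) j (c e) * \prod_(i < m) y i ^+ e i.

Definition alg_indep (K F : fieldType) (j : K -> F) (m : nat) (y : 'I_m -> F) :=
  forall d (c : {ffun 'I_m -> 'I_d} -> K), peval j c y = 0 -> forall e, c e = 0.

Definition trdeg (K F : fieldType) (j : K -> F) :=
  esup (fun m => exists y : 'I_m -> F, alg_indep j y).

(* For T ⊆ K, q prime of T, S ⊆ F, Q prime of S with j(T) ⊆ S:
   residue fields  K(q) = T_q / qT_q,  K(Q) = S_Q / QS_Q  (with representatives);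
   y (elements of S_Q) have algebraically independent residues in K(Q) over K(q). *)
Definition resid_indep (K F : fieldType) (j : K -> F) (T q : K -> Prop)
  (S Q : F -> Prop) (m : nat) (y : 'I_m -> F) :=
  (forall i, loc S Q (y i)) /\
  forall d (c : {ffun 'I_m -> 'I_d} -> K), (forall e, loc T q (c e)) ->
    locid S Q Q (peval j c y) -> forall e, locid T q q (c e).
Definition trdeg_res (K F : fieldType) (j : K -> F) (T q : K -> Prop) (S Q : F -> Prop) :=
  esup (fun m => exists y : 'I_m -> F, resid_indep j T q S Q y).

Definition dim_ineq (K F : fieldType) (T : K -> Prop) (st1 : (K -> Prop) -> (K -> Prop))
  (j : K -> F) (S : F -> Prop) (st2 : (F -> Prop) -> (F -> Prop)) :=
  forall Q : F -> Prop, qprime S st2 Q ->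
    let q := fun x => T x /\ Q (j x) in
    (seteq q zeroset \/ ssub (st1 q) (st1 T)) ->
    ele (eadd (st_ht S st2 Q) (trdeg_res j T q S Q))
        (eadd (st_ht T st1 q) (trdeg j)).

(* Main.v *)
(** Everything rests on chains of primes c_0 = 0 < ... < c_n = Q of S and their contractions to D.
    If every prime inside P[X] is extended, then a family of elements of S that is independent modulo
    c_(i+1) over D is still independent modulo c_i: otherwise divide a relation modulo c_i by a
    coefficient of least value for a valuation ring of the residue field of c_i dominating the local
    ring of c_(i+1); the resulting coefficients are residually algebraic over D by the quasi-Prufer
    property, while independence persists under algebraic extensions. When moreover c_i and c_(i+1)
    contract to the same prime of D, any element of c_(i+1) outside c_i can be added to the family.
    Descending from Q to 0 produces the inequality, since every change of contraction to D is also
    a step in a chain of primes of T.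
    Conversely, an unextended prime Q inside P[X] gives, again by dividing an element of Q by a
    coefficient of least value, a local overring (W, m) of D over P whose residue field is
    transcendental over that of P. Then m has the same height in D + m as in W, which contradicts the
    inequality for D + m in W; that height is finite by the inequality for D in D + m. *)

Require Import Defs.
From HB Require Import structures.
From mathcomp Require Import all_boot all_order all_algebra.
From mathcomp Require Import boolp ring.
From mathcomp Require classical_sets.
From Stdlib Require ClassicalEpsilon.
Set Implicit Arguments. Unset Strict Implicit. Unset Printing Implicit Defensive.
Import Order.TTheory GRing.Theory Num.Theory.
(* [subset] is also a notion of MathComp; this makes the one of Defs prevail. *)
Import Defs.
Local Open Scope ring_scope.

(** * Algebraic elements over a subring *)

(** The semistar operations enter only through quasi-maximal ideals. A nonzero prime is quasi-prime
    for the tilde operation exactly when it lies in a quasi-maximal ideal for the finite type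
    operation, so this property passes to every nonzero prime below it. Linkedness puts the
    contraction to [D] of a quasi-maximal ideal of [T] inside a quasi-maximal ideal of [D]. Below a
    given quasi-prime, everything therefore concerns ordinary chains of primes.

    For the converse, extension to the localization at a nonzero prime q of an overring [T] is a
    semistar operation for which q is quasi-maximal, and it is linked to [D] as soon as q contracts
    into a quasi-maximal ideal of [D]. This equips D + m and W with suitable operations.

    Rings, ideals and modules are predicates on a fixed field, and independence modulo an ideal is
    stated without quotients. A residue field appears only as the target of a map [rho] that is
    additive and multiplicative on a valuation-like ring [V]. *)

Section Subrings.
Variables (R : comNzRingType) (A : R -> Prop).
Hypothesis sA : is_subring A.

Lemma subring0 : A 0. Proof. by case: sA. Qed.
Lemma subring1 : A 1. Proof. by case: sA => _ []. Qed.
Lemma subringB x y : A x -> A y -> A (x - y).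
Proof. by case: sA => _ [_ [h _]]; apply: h. Qed.
Lemma subringM x y : A x -> A y -> A (x * y).
Proof. by case: sA => _ [_ [_ h]]; apply: h. Qed.
Lemma subringN x : A x -> A (- x).
Proof. by move=> Ax; rewrite -sub0r; apply: subringB => //; apply: subring0. Qed.
Lemma subringD x y : A x -> A y -> A (x + y).
Proof. by move=> Ax Ay; rewrite -[y]opprK; apply: subringB => //; apply: subringN. Qed.
Lemma subring_sum (I : Type) (r : seq I) (P : pred I) (f : I -> R) :
  (forall i, P i -> A (f i)) -> A (\sum_(i <- r | P i) f i).
Proof. by move=> h; elim/big_ind: _ => //; [apply: subring0 | apply: subringD]. Qed.
Lemma subring_prod (I : Type) (r : seq I) (P : pred I) (f : I -> R) :
  (forall i, P i -> A (f i)) -> A (\prod_(i <- r | P i) f i).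
Proof. by move=> h; elim/big_ind: _ => //; [apply: subring1 | apply: subringM]. Qed.
Lemma subringX x n : A x -> A (x ^+ n).
Proof.
move=> Ax; elim: n => [|n IH]; first by rewrite expr0; apply: subring1.
by rewrite exprS; apply: subringM.
Qed.

Section Ideals.
Variable I : R -> Prop.
Hypothesis iI : is_ideal A I.
Lemma ideal_sub x : I x -> A x. Proof. by case: iI => h _; apply: h. Qed.
Lemma ideal0 : I 0. Proof. by case: iI => _ []. Qed.
Lemma idealD x y : I x -> I y -> I (x + y).
Proof. by case: iI => _ [_ [h _]]; apply: h. Qed.
Lemma idealM a x : A a -> I x -> I (a * x).
Proof. by case: iI => _ [_ [_ h]]; apply: h. Qed.
Lemma idealN x : I x -> I (- x).
Proof.
move=> Ix; rewrite -mulN1r; apply: idealM => //.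
by apply: subringN; apply: subring1.
Qed.
Lemma idealB x y : I x -> I y -> I (x - y).
Proof. by move=> Ix Iy; apply: idealD => //; apply: idealN. Qed.
Lemma ideal_sum (J : Type) (r : seq J) (P : pred J) (f : J -> R) :
  (forall i, P i -> I (f i)) -> I (\sum_(i <- r | P i) f i).
Proof. by move=> h; elim/big_ind: _ => //; [apply: ideal0 | apply: idealD]. Qed.
Lemma ideal_addl x y : I x -> I (x + y) -> I y.
Proof. by move=> Ix Ixy; rewrite -[y](addKr x) addrC; apply: idealB. Qed.
End Ideals.
End Subrings.

(** [N] is a multiplicative set and [J] is stable under it; this form serves nonzero denominators as
    well as denominators outside a prime. *)
Lemma common_denominator (R : comNzRingType) (I : finType) (x : I -> R) (N J : R -> Prop) :
  N 1 -> (forall a b, N a -> N b -> N (a * b)) ->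
  (forall a b, N a -> J b -> J (a * b)) ->
  (forall i, exists2 b, N b & J (b * x i)) ->
  exists2 b, N b & forall i, J (b * x i).
Proof.
move=> N1 NM NJ h.
have /choice [b bP] : forall i, exists b, N b /\ J (b * x i).
  by move=> i; have [b] := h i; exists b.
exists (\prod_i b i).
  by elim/big_ind: _ => // i _; case: (bP i).
move=> i; rewrite (bigD1 i) //= [b i * _]mulrC -mulrA; apply: NJ.
  by elim/big_ind: _ => // k _; case: (bP k).
by case: (bP i).
Qed.

Section Fractions.
Variables (k : fieldType) (A : k -> Prop).
Hypothesis sA : is_subring A.

Definition fracs : k -> Prop :=
  fun x => exists a b, A a /\ A b /\ b != 0 /\ x = a / b.

Lemma fracs_incl x : A x -> fracs x.
Proof.
move=> Ax; exists x, 1; rewrite oner_eq0 divr1; split=> //; split=> //.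
exact: subring1.
Qed.

Lemma fracs_subring : is_subring fracs.
Proof.
split; first by apply: fracs_incl; apply: subring0.
split; first by apply: fracs_incl; apply: subring1.
split=> _ _ [a [b [Aa [Ab [b0 ->]]]]] [c [d [Ac [Ad [d0 ->]]]]].
  exists (a * d - c * b), (b * d); split.
    by apply: subringB => //; apply: subringM.
  split; first exact: subringM.
  split; first by rewrite mulf_neq0.
  by field; rewrite b0 d0.
exists (a * c), (b * d); split; first exact: subringM.
split; first exact: subringM.
split; first by rewrite mulf_neq0.
by field; rewrite b0 d0.
Qed.

Lemma fracsV x : fracs x -> fracs x^-1.
Proof.
move=> [a [b [Aa [Ab [b0 ->]]]]].
have [->|a0] := eqVneq a 0.
  by rewrite mul0r invr0; apply: fracs_incl; apply: subring0.
by exists b, a; rewrite invf_div.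
Qed.

Lemma fracs_common_denominator (I : finType) (x : I -> k) :
  (forall i, fracs (x i)) -> exists2 b, A b /\ b != 0 & forall i, A (b * x i).
Proof.
move=> xP; apply: (@common_denominator _ I x (fun b => A b /\ b != 0) A).
- by split; [apply: subring1 | apply: oner_neq0].
- by move=> a b [Aa a0] [Ab b0]; rewrite mulf_neq0 //; split=> //; apply: subringM.
- by move=> a b [Aa _] Ab; apply: subringM.
- move=> i; have [a [b [Aa [Ab [b0 ->]]]]] := xP i.
  by exists b => //; rewrite mulrC divfK.
Qed.

End Fractions.

Definition algebraic_over (k : fieldType) (A : k -> Prop) (u : k) :=
  exists2 p : {poly k}, p != 0 & polyin A p /\ root p u.

Section SubfieldAlgebraic.
Variables (k : fieldType) (A : k -> Prop).
Hypothesis sA : is_subring A.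
Hypothesis invA : forall x, A x -> A x^-1.

(** The subfield [A] is made into a field type so that the closure properties of integral elements
    apply: over a field, integral and algebraic mean the same. *)
Definition subfield_pred : pred k := fun x => `[<A x>].
Local Notation inA := subfield_pred.

Let inA_divring : divring_closed inA.
Proof.
split; first by apply/asboolP; apply: subring1.
- by move=> x y /asboolP Ax /asboolP Ay; apply/asboolP; apply: subringB.
- by move=> x y /asboolP Ax /asboolP Ay; apply/asboolP; apply: subringM => //; apply: invA.
Qed.

HB.instance Definition _ := GRing.isDivringClosed.Build k inA inA_divring.

Definition subfield_type : Type := {x : k | inA x}.
Local Notation L := subfield_type.
HB.instance Definition _ := SubType.on L.
HB.instance Definition _ := [Choice of L by <:].
HB.instance Definition _ := [SubChoice_isSubIntegralDomain of L by <:].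
HB.instance Definition _ := [SubIntegralDomain_isSubField of L by <:].

Let toA (p : {poly k}) : {poly L} := \poly_(i < size p) insubd (0 : L) p`_i.

Let algebraicE u : algebraic_over A u <-> integralOver (val : L -> k) u.
Proof.
split.
  move=> [p p0 [Ap pu]]; apply/integral_algebraic.
  have pE : map_poly (val : L -> k) (toA p) = p.
    apply/polyP => i; rewrite coef_map coef_poly.
    case: ltnP => [_|h]; last by rewrite nth_default.
    by rewrite /= insubdK //; apply/asboolP/Ap.
  exists (toA p); last by rewrite pE.
  by apply: contraNneq p0 => h; rewrite -pE h rmorph0.
move=> /integral_algebraic [p p0 pu]; exists (map_poly (val : L -> k) p).
  by rewrite map_poly_eq0.
split=> // i; rewrite coef_map; exact/asboolP/(valP (p`_i)).
Qed.

Lemma algebraic_over_subfieldD u v :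
  algebraic_over A u -> algebraic_over A v -> algebraic_over A (u + v).
Proof. by rewrite !algebraicE; apply: integral_add. Qed.

Lemma algebraic_over_subfieldM u v :
  algebraic_over A u -> algebraic_over A v -> algebraic_over A (u * v).
Proof. by rewrite !algebraicE; apply: integral_mul. Qed.

Lemma algebraic_over_subfield_root (p : {poly k}) u :
  p != 0 -> root p u -> polyin (algebraic_over A) p -> algebraic_over A u.
Proof.
move=> p0 pu Ap; apply/algebraicE; apply: (integral_root p0 pu).
by move=> x /(nthP 0) [i _ <-]; apply/algebraicE.
Qed.

End SubfieldAlgebraic.

Section Algebraic.
Variables (k : fieldType) (A : k -> Prop).
Hypothesis sA : is_subring A.

Lemma algebraic_over_mono (B : k -> Prop) u :
  subset A B -> algebraic_over A u -> algebraic_over B u.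
Proof. by move=> AB [p p0 [Ap pu]]; exists p => //; split=> // i; apply: AB. Qed.

(** Multiplying an equation by a common denominator of its coefficients keeps its roots. This
    carries the closure properties from subfields to subrings. *)
Lemma algebraic_over_fracs u : algebraic_over (fracs A) u <-> algebraic_over A u.
Proof.
split; last by apply: algebraic_over_mono => x; apply: fracs_incl.
move=> [p p0 [Ap pu]].
have [|b [Ab b0] bP] := fracs_common_denominator sA (x := fun i : 'I_(size p) => p`_i).
  by move=> i; apply: Ap.
exists (b *: p); first by rewrite scaler_eq0 negb_or b0.
split; last by rewrite rootZ.
move=> i; rewrite coefZ; have [h|h] := ltnP i (size p); first exact: (bP (Ordinal h)).
by rewrite nth_default // mulr0; apply: subring0.
Qed.

Let sFA := fracs_subring sA.
Let invFA := @fracsV k A sA.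

Lemma algebraic_overD u v :
  algebraic_over A u -> algebraic_over A v -> algebraic_over A (u + v).
Proof. by rewrite -!algebraic_over_fracs; apply: algebraic_over_subfieldD. Qed.

Lemma algebraic_overM u v :
  algebraic_over A u -> algebraic_over A v -> algebraic_over A (u * v).
Proof. by rewrite -!algebraic_over_fracs; apply: algebraic_over_subfieldM. Qed.

Lemma algebraic_over_root (p : {poly k}) u :
  p != 0 -> root p u -> polyin (algebraic_over A) p -> algebraic_over A u.
Proof.
move=> p0 pu Ap; rewrite -algebraic_over_fracs.
apply: (algebraic_over_subfield_root sFA invFA p0 pu) => i.
by rewrite algebraic_over_fracs; apply: Ap.
Qed.

Lemma algebraic_over_incl u : A u -> algebraic_over A u.
Proof.
move=> Au; exists ('X - u%:P); first by rewrite polyXsubC_eq0.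
split; last by rewrite root_XsubC.
move=> i; rewrite coefB coefX coefC; apply: subringB => //.
  by case: (i == 1)%N; [apply: subring1 | apply: subring0].
by case: (i == 0)%N; [ | apply: subring0].
Qed.

Lemma algebraic_over_sum (I : Type) (r : seq I) (f : I -> k) :
  (forall i, algebraic_over A (f i)) -> algebraic_over A (\sum_(i <- r) f i).
Proof.
move=> h; elim/big_ind: _ => //; last exact: algebraic_overD.
by apply: algebraic_over_incl; apply: subring0.
Qed.

End Algebraic.

(** * Independence modulo an ideal *)

Section Monomials.
Variable F : fieldType.

Definition monomial m d (y : 'I_m -> F) (e : {ffun 'I_m -> 'I_d}) : F :=
  \prod_(i < m) y i ^+ e i.

(** For a prime [I] of a ring that contains [A] and the family, this is algebraic independence of
    the residues modulo [I] over the image of [A]. With [zeroset] it is plain algebraic independence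
    over [A]. *)
Definition indep_mod (A I : F -> Prop) m (y : 'I_m -> F) :=
  forall d (c : {ffun 'I_m -> 'I_d} -> F), (forall e, A (c e)) ->
    I (\sum_e c e * monomial y e) -> forall e, I (c e).

Definition expcons m d (k : 'I_d) (e : {ffun 'I_m -> 'I_d}) : {ffun 'I_m.+1 -> 'I_d} :=
  [ffun i => if unlift ord0 i is Some j then e j else k].

Definition exptail m d (e : {ffun 'I_m.+1 -> 'I_d}) : {ffun 'I_m -> 'I_d} :=
  [ffun i => e (lift ord0 i)].

Lemma expcons_eta m d (e : {ffun 'I_m.+1 -> 'I_d}) : expcons (e ord0) (exptail e) = e.
Proof. by apply/ffunP => i; rewrite ffunE; case: unliftP => [j ->|->] //; rewrite ffunE. Qed.

Lemma expcons0 m d (k : 'I_d) (e : {ffun 'I_m -> 'I_d}) : expcons k e ord0 = k.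
Proof. by rewrite ffunE unlift_none. Qed.

Lemma exptail_cons m d (k : 'I_d) (e : {ffun 'I_m -> 'I_d}) : exptail (expcons k e) = e.
Proof. by apply/ffunP => i; rewrite !ffunE liftK. Qed.

Lemma sum_expcons m d (f : {ffun 'I_m.+1 -> 'I_d} -> F) :
  \sum_e f e = \sum_(k < d) \sum_(e : {ffun 'I_m -> 'I_d}) f (expcons k e).
Proof.
rewrite pair_big /= (reindex (fun p : 'I_d * {ffun 'I_m -> 'I_d} => expcons p.1 p.2)) //.
exists (fun e : {ffun 'I_m.+1 -> 'I_d} => (e ord0, exptail e)) => [[k e] _|e _] /=.
  by rewrite expcons0 exptail_cons.
exact: expcons_eta.
Qed.

Lemma monomial_cons m d (y : 'I_m.+1 -> F) (k : 'I_d) (e : {ffun 'I_m -> 'I_d}) :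
  monomial y (expcons k e) = y ord0 ^+ k * monomial (fun i => y (lift ord0 i)) e.
Proof.
rewrite /monomial big_ord_recl expcons0; congr (_ * _).
by apply: eq_bigr => i _; rewrite ffunE liftK.
Qed.

Lemma monomial_in (A : F -> Prop) m d (y : 'I_m -> F) (e : {ffun 'I_m -> 'I_d}) :
  is_subring A -> (forall i, A (y i)) -> A (monomial y e).
Proof. by move=> sA Ay; apply: subring_prod => // i _; apply: subringX. Qed.

Lemma sum_monomials_cons m d (y : 'I_m.+1 -> F) (c : {ffun 'I_m.+1 -> 'I_d} -> F) :
  \sum_e c e * monomial y e =
  \sum_(k < d) y ord0 ^+ k *
    \sum_(e : {ffun 'I_m -> 'I_d}) c (expcons k e) * monomial (fun i => y (lift ord0 i)) e.
Proof.
rewrite sum_expcons; apply: eq_bigr => k _; rewrite mulr_sumr.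
by apply: eq_bigr => e _; rewrite monomial_cons mulrCA.
Qed.

Lemma monomial_widen m d d' (dd : (d <= d')%N) (y : 'I_m -> F) (e : {ffun 'I_m -> 'I_d}) :
  monomial y [ffun i => widen_ord dd (e i)] = monomial y e.
Proof. by apply: eq_bigr => i _; rewrite ffunE. Qed.

Lemma indep_mod_fracs (A : F -> Prop) m (y : 'I_m -> F) : is_subring A ->
  indep_mod A zeroset y -> indep_mod (fracs A) zeroset y.
Proof.
move=> sA iy d c Fc cy0 e.
have [b [Ab b0] bP] := fracs_common_denominator sA Fc.
have /(_ e) : forall e, zeroset (b * c e).
  apply: (iy d (fun e => b * c e)) => //.
  under eq_bigr => e' _ do rewrite -mulrA.
  by rewrite -mulr_sumr [X in _ * X]cy0 /zeroset mulr0.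
by rewrite /zeroset => /eqP; rewrite mulf_eq0 (negPf b0) => /eqP.
Qed.

Definition adjoin (A : F -> Prop) (x : F) : F -> Prop :=
  fun z => exists2 p : {poly F}, polyin A p & z = p.[x].

Lemma polyin_subring (A : F -> Prop) : is_subring A -> is_subring (polyin A).
Proof.
move=> sA; split; first by move=> i; rewrite coef0; apply: subring0.
split; first by move=> i; rewrite coef1; case: eqP => _; [apply: subring1|apply: subring0].
split=> p q Ap Aq i; first by rewrite coefB; apply: subringB.
by rewrite coefM; apply: subring_sum => // j _; apply: subringM.
Qed.

Lemma polyin_ideal (A I : F -> Prop) : is_subring A -> is_ideal A I ->
  is_ideal (polyin A) (polyin I).
Proof.
move=> sA iI; split; first by move=> p Ip i; apply: (ideal_sub iI).
split; first by move=> i; rewrite coef0; apply: (ideal0 iI).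
split=> [p q Ip Iq i|p q Ap Iq i]; first by rewrite coefD; apply: (idealD iI).
by rewrite coefM; apply: (ideal_sum iI) => j _; apply: (idealM iI).
Qed.

Lemma polyin_horner (A : F -> Prop) (p : {poly F}) x :
  is_subring A -> polyin A p -> A x -> A p.[x].
Proof.
move=> sA Ap Ax; rewrite horner_coef; apply: subring_sum => // i _.
by apply: subringM => //; apply: subringX.
Qed.

Lemma adjoin_subring (A : F -> Prop) x : is_subring A -> is_subring (adjoin A x).
Proof.
move=> sA; have sP := polyin_subring sA.
split; first by exists 0; [apply: (subring0 sP)|rewrite horner0].
split; first by exists 1; [apply: (subring1 sP)|rewrite hornerC].
split=> _ _ [p Ap ->] [q Aq ->].
  by exists (p - q); [apply: (subringB sP)|rewrite hornerD hornerN].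
by exists (p * q); [apply: (subringM sP)|rewrite hornerM].
Qed.

Lemma adjoin_incl (A : F -> Prop) x : is_subring A -> subset A (adjoin A x).
Proof.
move=> sA a Aa; exists a%:P; last by rewrite hornerC.
by move=> i; rewrite coefC; case: eqP => _ //; apply: subring0.
Qed.

Lemma adjoin_gen (A : F -> Prop) x : is_subring A -> adjoin A x x.
Proof.
move=> sA; exists 'X; last by rewrite hornerX.
by move=> i; rewrite coefX; case: eqP => _; [apply: subring1|apply: subring0].
Qed.

Lemma indep_mod_head (A : F -> Prop) m (y : 'I_m.+1 -> F) : is_subring A ->
  indep_mod A zeroset y -> ~ algebraic_over A (y ord0).
Proof.
move=> sA iy [p p0 [Ap /rootP py0]].
have /prednK sp : (0 < size p)%N by rewrite size_poly_gt0.
(* A polynomial in the first variable is a relation supported on the exponents that vanish in all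
   other variables. Writing the size as a successor provides [ord0]. *)
pose z := [ffun=> ord0] : {ffun 'I_m -> 'I_(size p).-1.+1}.
pose c (e : {ffun 'I_m.+1 -> 'I_(size p).-1.+1}) := if exptail e == z then p`_(e ord0) else 0.
have c0 : forall e, zeroset (c e).
  apply: (iy _ c) => [e|].
    by rewrite /c; case: ifP => _ //; apply: subring0.
  rewrite /zeroset sum_monomials_cons -[RHS]py0 horner_coef -[in RHS]sp.
  apply: eq_bigr => k _; rewrite (bigD1 z) //= big1 ?addr0; last first.
    by move=> e ez; rewrite /c exptail_cons (negPf ez) mul0r.
  rewrite /c exptail_cons eqxx expcons0 mulrC /monomial big1 ?mulr1 //.
  by move=> i _; rewrite ffunE expr0.
have := c0 (expcons ord_max z); rewrite /c exptail_cons eqxx expcons0 /=.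
by rewrite /zeroset -/(lead_coef p) => /eqP; rewrite lead_coef_eq0 (negPf p0).
Qed.

(** A coefficient in [A[y0]] is a polynomial in [y0], so a relation over [A[y0]] among the other
    variables unfolds into a relation over [A] among all of them. *)
Lemma indep_mod_adjoin (A : F -> Prop) m (y : 'I_m.+1 -> F) : is_subring A ->
  indep_mod A zeroset y ->
  indep_mod (adjoin A (y ord0)) zeroset (fun i => y (lift ord0 i)).
Proof.
move=> sA iy d c Ac cy0.
have /choice [p pP] : forall e, exists p : {poly F}, polyin A p /\ c e = p.[y ord0].
  by move=> e; have [p] := Ac e; exists p.
(* All variables share one bound on exponents, so [D] must exceed both the old exponents and the
   degrees in the first variable. *)
pose D := (d + \max_e size (p e))%N.
have dD : (d <= D)%N by apply: leq_addr.
have sD e : (size (p e) <= D)%N.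
  by apply: leq_trans (leq_addl _ _); apply: leq_bigmax.
pose w (e : {ffun 'I_m -> 'I_d}) := [ffun i => widen_ord dD (e i)] : {ffun 'I_m -> 'I_D}.
have w_inj : injective w.
  move=> e1 e2 /ffunP h; apply/ffunP => i; have := h i; rewrite !ffunE => /(congr1 val) /= ?.
  exact: val_inj.
(* As [w] is injective, this sum has at most one term; it is empty, hence zero, on the exponents
   that [w] does not reach. *)
pose C (E : {ffun 'I_m.+1 -> 'I_D}) := \sum_(e | w e == exptail E) (p e)`_(E ord0).
have C0 : forall E, zeroset (C E).
  apply: (iy D C) => [E|].
    by apply: subring_sum => // e _; case: (pP e).
  rewrite /zeroset sum_monomials_cons -[RHS]cy0.
  transitivity (\sum_(k < D) \sum_e y ord0 ^+ k * ((p e)`_k * monomial (fun i => y (lift ord0 i)) e)).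
    apply: eq_bigr => k _; rewrite mulr_sumr [RHS](partition_big w predT) //=.
    apply: eq_bigr => E _; rewrite /C exptail_cons expcons0 mulr_suml mulr_sumr.
    by apply: eq_bigr => e /eqP <-; rewrite monomial_widen.
  rewrite exchange_big; apply: eq_bigr => e _ /=.
  have [_ ->] := pP e; rewrite (horner_coef_wide _ (sD e)) mulr_suml.
  by apply: eq_bigr => k _; rewrite mulrCA mulrA mulrAC.
move=> e; rewrite /zeroset; have [_ ->] := pP e.
rewrite (horner_coef_wide _ (sD e)) big1 // => k _.
have := C0 (expcons k (w e)); rewrite /C exptail_cons expcons0 (bigD1 e) //= big1.
  by rewrite addr0 => ->; rewrite mul0r.
by move=> e' /andP [/eqP /w_inj -> ]; rewrite eqxx.
Qed.

(** Collect a relation by the monomials in the variables other than [y0]. Its coefficients are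
    algebraic over [A[y0]], hence zero by induction. Each of them is a polynomial in [y0] with
    coefficients algebraic over [A]; if it were not the zero polynomial, [y0] would be algebraic
    over [A]. *)
Lemma indep_mod_algebraic (A : F -> Prop) m (y : 'I_m -> F) : is_subring A ->
  indep_mod A zeroset y -> indep_mod (algebraic_over A) zeroset y.
Proof.
elim: m A y => [|m IH] A y sA iy d c Ac cy0 e.
  have := cy0; rewrite /zeroset (bigD1 e) //= big1 ?addr0.
    by rewrite /monomial big_ord0 mulr1.
  by move=> e' /eqP; case; apply/ffunP => -[].
have sA1 := adjoin_subring (y ord0) sA.
have {}IH := IH _ _ sA1 (indep_mod_adjoin sA iy).
pose c' (e : {ffun 'I_m -> 'I_d}) := \sum_(k < d) y ord0 ^+ k * c (expcons k e).
have AA1 u : algebraic_over A u -> algebraic_over (adjoin A (y ord0)) u.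
  by apply: algebraic_over_mono => //; apply: adjoin_incl.
have c'0 : forall e, zeroset (c' e).
  apply: IH => [e'|].
    apply: algebraic_over_sum => // k; apply: algebraic_overM => //; last exact: AA1.
    by apply: algebraic_over_incl => //; apply: subringX => //; apply: adjoin_gen.
  have := cy0; rewrite /zeroset sum_monomials_cons => {2}<-.
  under eq_bigr => e' _ do rewrite /c' mulr_suml.
  rewrite exchange_big; apply: eq_bigr => k _ /=; rewrite mulr_sumr.
  by apply: eq_bigr => e' _; rewrite mulrA.
pose p := \poly_(k < d) (if insub k is Some k' then c (expcons k' (exptail e)) else 0).
have pE (k : 'I_d) : p`_k = c (expcons k (exptail e)) by rewrite coef_poly ltn_ord valK.
have py0 : root p (y ord0).
  apply/rootP; rewrite horner_poly -[RHS](c'0 (exptail e)); apply: eq_bigr => k _.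
  by rewrite valK mulrC.
have p0 : p = 0.
  apply/eqP; apply: contrapT => /negP p0.
  apply: (indep_mod_head sA iy); apply: (algebraic_over_root sA p0 py0) => k.
  rewrite coef_poly; case: ifP => h; last by apply: algebraic_over_incl => //; apply: subring0.
  by rewrite insubT.
by rewrite /zeroset -(expcons_eta e) -pE p0 coef0.
Qed.

Definition vcons m (u : F) (y : 'I_m -> F) : 'I_m.+1 -> F :=
  fun i => if unlift ord0 i is Some k then y k else u.

(** Sort a relation modulo [Q'] by powers of [u], with coefficients [g k]. Once the terms below [k]
    are known to lie in [Q'], the rest is divisible by [u ^+ k], which can be cancelled because [Q']
    is prime and misses [u]. What remains is [g k] plus a multiple of [u], so [g k] lies in [Q];
    independence modulo [Q] puts its coefficients in [Q], hence in [Q']. *)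
Lemma indep_mod_cons (S A Q' Q : F -> Prop) m (y : 'I_m -> F) u :
  is_subring S -> is_prime S Q' -> is_prime S Q -> subset Q' Q ->
  subset A S -> (forall x, A x -> Q x -> Q' x) ->
  (forall i, S (y i)) -> Q u -> ~ Q' u ->
  indep_mod A Q y -> indep_mod A Q' (vcons u y).
Proof.
move=> sS [iQ' [Q'1 pQ']] [iQ _] Q'Q AS AQ Sy Qu Q'u iy d c Ac Q's.
have Su := ideal_sub iQ Qu.
have tailE : (fun i => vcons u y (lift ord0 i)) = y.
  by apply/funext => i; rewrite /vcons liftK.
have headE : vcons u y ord0 = u by rewrite /vcons unlift_none.
pose g k := \sum_(e : {ffun 'I_m -> 'I_d}) c (expcons k e) * monomial y e.
have Sm (e : {ffun 'I_m -> 'I_d}) : S (monomial y e) by apply: monomial_in.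
have Sg k : S (g k) by apply: subring_sum => // e _; apply: subringM => //; apply: AS.
rewrite sum_monomials_cons tailE headE in Q's.
suff h n : forall k : 'I_d, (k = n :> nat) -> forall e, Q' (c (expcons k e)).
  by move=> e; rewrite -(expcons_eta e); apply: h.
elim/ltn_ind: n => n IH k kn e.
apply: AQ => //; move: e; apply: iy => //.
change (Q (g k)).
pose t := \sum_(l < d | (k < l)%N) u ^+ (l - k) * g l.
have Qt : Q t.
  apply: (ideal_sum iQ) => l kl; rewrite mulrC; apply: (idealM iQ) => //.
  have -> : (l - k = (l - k).-1.+1)%N by rewrite prednK // subn_gt0.
  by rewrite exprSr; apply: (idealM iQ) => //; apply: subringX.
have St : S t by apply: (ideal_sub iQ).
suff : Q' (g k + t) by move/Q'Q; rewrite addrC; apply: (ideal_addl sS iQ).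
have Sgt : S (g k + t) by apply: subringD.
have uX j : Q' (u ^+ j * (g k + t)) -> Q' (g k + t).
  elim: j => [|j IHj]; first by rewrite mul1r.
  rewrite exprS -mulrA => /pQ' [] // .
  by apply: subringM => //; apply: subringX.
apply: (uX k).
move: Q's; rewrite (bigID (fun l : 'I_d => (l < k)%N)) /=.
have Q'1s : Q' (\sum_(l < d | (l < k)%N) u ^+ l * g l).
  apply: (ideal_sum iQ') => l lk; apply: (idealM iQ'); first exact: subringX.
  apply: (ideal_sum iQ') => e _; rewrite mulrC; apply: (idealM iQ') => //.
  by apply: (IH l) => //; rewrite -kn.
move/(ideal_addl sS iQ' Q'1s).
rewrite (bigD1 k) /=; last by rewrite ltnn.
rewrite mulrDr [u ^+ k * t]mulr_sumr; congr (Q' (_ + _)); apply: eq_big => l.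
  by rewrite -leqNgt ltn_neqAle andbC eq_sym.
rewrite -leqNgt => /andP [kl _]; by rewrite mulrA -exprD subnKC.
Qed.

End Monomials.

(** * Valuation rings *)

Section ResidueField.
Local Open Scope quotient_scope.
Variables (F : fieldType) (V I : F -> Prop).
Hypotheses (sV : is_subring V) (iI : is_ideal V I) (I1 : ~ I 1).
Hypothesis unitV : forall x, V x -> ~ I x -> V x^-1.

Definition valuation_pred : pred F := fun x => `[<V x>].
Local Notation inV := valuation_pred.

Let inV_subring : subring_closed inV.
Proof.
split; first by apply/asboolP; apply: subring1.
- by move=> x y /asboolP Ax /asboolP Ay; apply/asboolP; apply: subringB.
- by move=> x y /asboolP Ax /asboolP Ay; apply/asboolP; apply: subringM.
Qed.

HB.instance Definition _ := GRing.isSubringClosed.Build F inV inV_subring.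

Definition valuation_type : Type := {x : F | inV x}.
Local Notation V' := valuation_type.
HB.instance Definition _ := SubType.on V'.
HB.instance Definition _ := [Choice of V' by <:].
HB.instance Definition _ := [SubChoice_isSubComNzRing of V' by <:].

Let V'P (x : V') : V (val x). Proof. exact/asboolP/(valP x). Qed.

Definition residue_pred : pred V' := fun x => `[<I (val x)>].
Local Notation inI := residue_pred.

Let inI_closed : idealr_closed inI.
Proof.
split; first by apply/asboolP; rewrite rmorph0; exact (ideal0 iI).
  by apply/negP => /asboolP; rewrite rmorph1.
move=> a x y /asboolP Ix /asboolP Iy; apply/asboolP.
rewrite rmorphD rmorphM; apply: (idealD iI) => //.
by apply: (idealM iI) => //; apply: V'P.
Qed.

HB.instance Definition _ := isIdealr.Build V' inI inI_closed.

Definition residue_type : Type := {ideal_quot (residue_pred : idealr V')}.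
Local Notation k := residue_type.
HB.instance Definition _ := GRing.ComNzRing.on k.
HB.instance Definition _ := EqQuotient.on k.

(** The residue map is total on [F], with the junk value 0 outside [V]; this is why its laws are
    stated for elements of [V] only. *)
Let pi (x : F) : k := (\pi_k (insubd (0 : V') x)).

Let insubdV x (Vx : V x) : val (insubd (0 : V') x) = x.
Proof. by rewrite insubdK //; apply/asboolP. Qed.

Let insubd_val (x : V') : insubd (0 : V') (val x) = x.
Proof. exact: valKd. Qed.

Let pi1 : pi 1 = 1.
Proof.
rewrite /pi (_ : insubd _ _ = 1); first exact: (rmorph1 (\pi_k : V' -> k)).
by apply: val_inj; rewrite insubdV ?rmorph1 //; apply: subring1.
Qed.

Let piD x y : V x -> V y -> pi (x + y) = pi x + pi y.
Proof.
move=> Vx Vy; rewrite /pi -(rmorphD (\pi_k : V' -> k)); congr (\pi_k _).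
by apply: val_inj; rewrite rmorphD /= !insubdV //; apply: subringD.
Qed.

Let piM x y : V x -> V y -> pi (x * y) = pi x * pi y.
Proof.
move=> Vx Vy; rewrite /pi -(rmorphM (\pi_k : V' -> k)); congr (\pi_k _).
by apply: val_inj; rewrite rmorphM /= !insubdV //; apply: subringM.
Qed.

Let pi_eq0 x : V x -> pi x = 0 <-> I x.
Proof.
move=> Vx; rewrite -(rmorph0 (\pi_k : V' -> k)); split.
  by move/eqP; rewrite -Quotient.idealrBE subr0 => /asboolP; rewrite insubdV.
by move=> Ix; apply/eqP; rewrite -Quotient.idealrBE subr0; apply/asboolP; rewrite insubdV.
Qed.

Let pi_surj z : exists2 x, V x & pi x = z.
Proof. by exists (val (repr z)) => //; rewrite /pi insubd_val reprK. Qed.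

Let inv (z : k) : k := if z == 0 then 0 else pi (val (repr z))^-1.

Let mulVk z : z != 0 -> inv z * z = 1.
Proof.
move=> z0; rewrite /inv (negPf z0); have [x Vx xz] := pi_surj z.
have Vr := V'P (repr z).
have Ir : ~ I (val (repr z)).
  by move/(pi_eq0 Vr); rewrite /pi insubd_val reprK; apply/eqP.
have zE : z = pi (val (repr z)) by rewrite /pi insubd_val reprK.
rewrite [X in _ * X]zE -piM //; last exact: unitV.
rewrite mulVf ?pi1 //; apply/eqP => h; apply: Ir; rewrite h; exact: (ideal0 iI).
Qed.

Let inv0 : inv 0 = 0. Proof. by rewrite /inv eqxx. Qed.

HB.instance Definition _ := GRing.ComNzRing_isField.Build k mulVk inv0.

Lemma residue_field : exists (kappa : fieldType) (rho : F -> kappa),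
  [/\ rho 1 = 1,
      forall x y, V x -> V y -> rho (x + y) = rho x + rho y,
      forall x y, V x -> V y -> rho (x * y) = rho x * rho y &
      forall x, V x -> rho x = 0 <-> I x].
Proof. by exists k, pi. Qed.

End ResidueField.

Lemma zorn_above (T : Type) (good : (T -> Prop) -> Prop) (X0 : T -> Prop) :
  good X0 ->
  (forall C : (T -> Prop) -> Prop, (exists X, C X) -> (forall X, C X -> good X) ->
    (forall X Y, C X -> C Y -> subset X Y \/ subset Y X) ->
    good (fun t => exists2 X, C X & X t)) ->
  exists M, [/\ good M, subset X0 M & forall Y, good Y -> subset M Y -> subset Y M].
Proof.
move=> g0 gU.
(* Adjoining [X0] to every set makes Zorn's lemma range over all sets, and makes the union of the
   empty chain good, since it becomes [X0]. *)
pose U (X : T -> Prop) : T -> Prop := fun t => X0 t \/ X t.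
have UE X : subset X0 X -> U X = X.
  move=> h; apply/predeqP => t; split; last by right.
  by case=> // /h.
have [C CP Ctot|A [gA maxA]] := @classical_sets.Zorn_bigcup T (fun X => good (U X)).
  have [[X CX]|nC] := pselect (exists X, C X); last first.
    rewrite (_ : U _ = X0) //; apply/predeqP => t; split; last by left.
    by case=> // -[X CX _]; case: nC; exists X.
  pose C' Z := exists2 Y, C Y & Z = U Y.
  have -> : U (classical_sets.bigcup C (fun X => X)) = (fun t => exists2 Z, C' Z & Z t).
    apply/predeqP => t; split.
      case=> [X0t|[Y CY Yt]]; first by exists (U X); [exists X|left].
      by exists (U Y); [exists Y|right].
    by case=> _ [Y CY ->] [|Yt]; [left|right; exists Y].
  apply: gU; first by exists (U X), X.
    by move=> _ [Y CY ->]; apply: CP.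
  move=> _ _ [Y CY ->] [Z CZ ->]; case: (Ctot Y Z CY CZ) => h; [left|right].
    by move=> t [|/h]; [left|right].
  by move=> t [|/h]; [left|right].
exists (U A); split=> // [t|Y gY AY]; first by left.
apply: contrapT => nYA; apply: (maxA Y).
  split=> [t At|h]; first by apply: AY; right.
  by apply: nYA => t /h; right.
by rewrite UE // => t X0t; apply: AY; left.
Qed.

(** * Maximal pairs of a ring and a proper ideal inside a local ring *)

Section RelativeValuation.
Variable F : fieldType.
Variables (B n S Q : F -> Prop).
Hypotheses (sB : is_subring B) (in_ : is_ideal B n).
Hypothesis unitB : forall x, B x -> ~ n x -> B x^-1.
Hypotheses (sS : is_subring S) (SB : subset S B).
Hypotheses (iQ : is_ideal S Q) (Q1 : ~ Q 1) (SnQ : forall x, S x -> n x -> Q x).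

Let good_pair (V I : F -> Prop) :=
  [/\ is_subring V, subset V B, is_ideal V I & ~ I 1].

(** A ring and its ideal are coded as one subset of [F * bool], so that inclusion orders both at
    once and Zorn's lemma on sets applies. *)
Let pair (V I : F -> Prop) (p : F * bool) : Prop := if p.2 then V p.1 else I p.1.
Let good (X : F * bool -> Prop) := good_pair (fun x => X (x, true)) (fun x => X (x, false)).

Let plus (X Y : F -> Prop) : F -> Prop := fun z => exists x y, X x /\ Y y /\ z = x + y.

(** Adding [n] to both members forces [n] into the ideal of every larger pair. The ideal stays
    proper: if 1 = q + x with q in [Q] and x in [n], then x = 1 - q lies in [S] and in [n], hence in
    [Q], and so does 1. *)
Let good_base : good (pair (plus S n) (plus Q n)).
Proof.
split; rewrite /pair /=.
- split; first by exists 0, 0; rewrite addr0; split; [apply: subring0|split=> //; apply: (ideal0 in_)].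
  split; first by exists 1, 0; rewrite addr0; split; [apply: subring1|split=> //; apply: (ideal0 in_)].
  split=> _ _ [s [x [Ss [nx ->]]]] [t [y [St [ny ->]]]].
    exists (s - t), (x - y); split; first exact: subringB.
    by split; [apply: (idealB sB in_)|rewrite opprD addrACA].
  exists (s * t), (s * y + t * x + x * y); split; first exact: subringM.
  split; last by ring.
  apply: (idealD in_); last by apply: (idealM in_) => //; apply: (ideal_sub in_).
  by apply: (idealD in_); apply: (idealM in_) => //; apply: SB.
- move=> _ [s [x [Ss [nx ->]]]]; apply: subringD => //; first exact: SB.
  exact: (ideal_sub in_).
- split; first by move=> _ [q [x [Qq [nx ->]]]]; exists q, x; split=> //; apply: (ideal_sub iQ).
  split; first by exists 0, 0; rewrite addr0; split; [apply: (ideal0 iQ)|split=> //; apply: (ideal0 in_)].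
  split=> [_ _ [s [x [Qs [nx ->]]]] [t [y [Qt [ny ->]]]]|_ _ [s [x [Ss [nx ->]]]] [q [y [Qq [ny ->]]]]].
    exists (s + t), (x + y); split; first exact: (idealD iQ).
    by split; [apply: (idealD in_)|rewrite addrACA].
  exists (s * q), (s * y + q * x + x * y); split; first exact: (idealM iQ).
  split; last by ring.
  apply: (idealD in_); last by apply: (idealM in_) => //; apply: (ideal_sub in_).
  by apply: (idealD in_); apply: (idealM in_) => //; apply: SB => //; apply: (ideal_sub iQ).
- move=> [q [x [Qq [nx h]]]]; apply: Q1.
  have Sq := ideal_sub iQ Qq.
  have xE : 1 - q = x by rewrite h addrC addKr.
  rewrite (_ : 1 = q + (1 - q)); last by ring.
  apply: (idealD iQ) => //; apply: SnQ; last by rewrite xE.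
  by apply: subringB => //; apply: subring1.
Qed.

Let good_chain (C : (F * bool -> Prop) -> Prop) : (exists X, C X) ->
  (forall X, C X -> good X) ->
  (forall X Y, C X -> C Y -> subset X Y \/ subset Y X) ->
  good (fun t => exists2 X, C X & X t).
Proof.
move=> [X0 CX0] gC totC.
have two a b : (exists2 X, C X & X a) -> (exists2 X, C X & X b) ->
    exists X, C X /\ X a /\ X b.
  move=> [X CX Xa] [Y CY Yb]; case: (totC X Y CX CY) => h.
    by exists Y; split=> //; split=> //; apply: h.
  by exists X; split=> //; split=> //; apply: h.
split=> /=.
- split; first by exists X0 => //; case: (gC _ CX0) => sX _ _ _; apply: (subring0 sX).
  split; first by exists X0 => //; case: (gC _ CX0) => sX _ _ _; apply: (subring1 sX).
  split=> x y hx hy; have [X [CX [Xx Xy]]] := two _ _ hx hy; exists X => //;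
    case: (gC _ CX) => sX _ _ _; [exact: (subringB sX)|exact: (subringM sX)].
- by move=> x [X CX Xx]; case: (gC _ CX) => _ h _ _; apply: h.
- split; first by move=> x [X CX Xx]; exists X => //; case: (gC _ CX) => _ _ h _; apply: (ideal_sub h).
  split; first by exists X0 => //; case: (gC _ CX0) => _ _ h _; apply: (ideal0 h).
  split=> x y hx hy; have [X [CX [Xx Xy]]] := two _ _ hx hy; exists X => //;
    case: (gC _ CX) => sX _ iX _; [exact: (idealD iX)|exact: (idealM iX)].
- by move=> [X CX]; case: (gC _ CX).
Qed.

Section Maximal.
Variables (V I : F -> Prop).
Hypothesis (gVI : good_pair V I).
Hypotheses (SV : subset S V) (nI : subset n I).
Hypothesis maxVI : forall V' I', good_pair V' I' -> subset V V' -> subset I I' ->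
  subset V' V /\ subset I' I.

Let sV : is_subring V. Proof. by case: gVI. Qed.
Let VB : subset V B. Proof. by case: gVI. Qed.
Let iI : is_ideal V I. Proof. by case: gVI. Qed.
Let I1 : ~ I 1. Proof. by case: gVI. Qed.

(** By maximality it is enough that inverting all of 1 + [I] gives a good pair. An element 1 + j is
    outside [n], as [n] is inside [I] and [I] is proper, so its inverse is in [B]; and 1 = a / (1 +
    j) with a and j in [I] would put 1 in [I]. *)
Let inv1p i : I i -> V (1 + i)^-1.
Proof.
move=> Ii.
pose L (X : F -> Prop) : F -> Prop := fun z => exists a j, X a /\ I j /\ z = a / (1 + j).
have n0 j : I j -> 1 + j != 0.
  move=> Ij; apply/eqP => h; apply: I1; rewrite (_ : 1 = - j); last by rewrite -[RHS]add0r -h addrK.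
  exact: (idealN sV iI).
have Vj j : I j -> V (1 + j).
  by move=> Ij; apply: subringD => //; [apply: subring1|apply: (ideal_sub iI)].
have In j k : I j -> I k -> I (j + k + j * k).
  move=> Ij Ik; apply: (idealD iI); first exact: (idealD iI).
  by apply: (idealM iI) => //; apply: (ideal_sub iI).
have LI X : subset X (L X).
  by move=> x Xx; exists x, 0; rewrite addr0 divr1; split=> //; split=> //; apply: (ideal0 iI).
have [|||h _] := maxVI (V' := L V) (I' := L I); try exact: LI.
  split.
  - split; first by apply: LI; apply: subring0.
    split; first by apply: LI; apply: subring1.
    split=> _ _ [a [j [Va [Ij ->]]]] [b [k [Vb [Ik ->]]]].
      exists (a * (1 + k) - b * (1 + j)), (j + k + j * k); split.
        by apply: subringB => //; apply: subringM => //; apply: Vj.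
      split; first exact: In.
      have -> : 1 + (j + k + j * k) = (1 + j) * (1 + k) by ring.
      by field; rewrite !n0.
    exists (a * b), (j + k + j * k); split; first exact: subringM.
    split; first exact: In.
    have -> : 1 + (j + k + j * k) = (1 + j) * (1 + k) by ring.
    by field; rewrite !n0.
  - move=> _ [a [j [Va [Ij ->]]]]; apply: subringM => //; first exact: VB.
    apply: unitB; first exact/VB/Vj.
    by move/nI => h; apply: I1; apply: (ideal_addl sV iI Ij); rewrite addrC.
  - split.
      move=> _ [a [j [Ia [Ij ->]]]]; exists a, j; split=> //; exact: (ideal_sub iI).
    split; first by apply: LI; apply: (ideal0 iI).
    split=> _ _ [a [j [Va [Ij ->]]]] [b [k [Vb [Ik ->]]]].
      exists (a * (1 + k) + b * (1 + j)), (j + k + j * k); split.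
        by rewrite [a * _]mulrC [b * _]mulrC; apply: (idealD iI); apply: (idealM iI) => //; apply: Vj.
      split; first exact: In.
      have -> : 1 + (j + k + j * k) = (1 + j) * (1 + k) by ring.
      by field; rewrite !n0.
    exists (a * b), (j + k + j * k); split; first exact: (idealM iI).
    split; first exact: In.
    have -> : 1 + (j + k + j * k) = (1 + j) * (1 + k) by ring.
    by field; rewrite !n0.
  - move=> [a [j [Ia [Ij h]]]]; apply: I1; apply: (ideal_addl sV iI Ij).
    rewrite addrC (_ : 1 + j = a) //.
    by rewrite -[RHS](divfK (n0 _ Ij)) -h mul1r.
apply: h; exists 1, i; split; first exact: subring1.
by split=> //; rewrite mul1r.
Qed.

(** If the ideal generated by [I] and [x] contains 1, then some a * x has the form 1 - i and is
    invertible by [inv1p]. Otherwise this ideal is proper and maximality puts [x] in [I]. *)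
Let unitV x : V x -> ~ I x -> V x^-1.
Proof.
move=> Vx Ix.
pose J z := exists a i, V a /\ I i /\ z = a * x + i.
have [[a [i [Va [Ii h]]]]|J1] := pselect (J 1).
  have E : a * x = 1 + - i by rewrite h addrK.
  have Vi := inv1p (idealN sV iI Ii).
  have x0 : x != 0 by apply/eqP => h0; apply: Ix; rewrite h0; apply: (ideal0 iI).
  have i0 : 1 - i != 0.
    apply/eqP => h0; apply: I1; rewrite (_ : 1 = i) //.
    by rewrite -[RHS]add0r -h0 subrK.
  have -> : x^-1 = a * (1 - i)^-1; last exact: subringM.
  by apply: (mulfI x0); rewrite mulfV // mulrA [x * a]mulrC E mulfV.
case: Ix; have [|||_] := @maxVI V J; last apply.
- split=> //; split.
    by move=> _ [a [i [Va [Ii ->]]]]; apply: subringD; [|apply: subringM|apply: (ideal_sub iI)].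
  split; first by exists 0, 0; rewrite mul0r addr0; split; [apply: subring0|split=> //; apply: (ideal0 iI)].
  split=> [_ _ [a [i [Va [Ii ->]]]] [b [k [Vb [Ik ->]]]]|c _ Vc [a [i [Va [Ii ->]]]]].
    exists (a + b), (i + k); split; first exact: subringD.
    by split; [apply: (idealD iI)|ring].
  exists (c * a), (c * i); split; first exact: subringM.
  by split; [apply: (idealM iI)|ring].
- by [].
- by move=> i Ii; exists 0, i; rewrite mul0r add0r; split=> //; apply: subring0.
- by exists 1, 0; rewrite mul1r addr0; split; [apply: subring1|split=> //; apply: (ideal0 iI)].
Qed.

(** Otherwise [V[x]], with the extension of [I] to it, would be a good pair larger than the maximal
    one. *)
Let adjoin_unit x : B x -> ~ V x -> exists2 p, polyin I p & p.[x] = 1.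
Proof.
move=> Bx Vx; apply: contrapT => h; apply: Vx.
have [|||h1 _] := @maxVI (adjoin V x) (fun z => exists2 p, polyin I p & z = p.[x]).
- have sP := polyin_subring sV; have iP := polyin_ideal sV iI.
  split; first exact: adjoin_subring.
  + by move=> _ [p Vp ->]; apply: polyin_horner => // i; apply: VB.
  + split; first by move=> _ [p Ip ->]; exists p => //; apply: (ideal_sub iP).
    split; first by exists 0; [apply: (ideal0 iP)|rewrite horner0].
    split=> _ _ [p Vp ->] [q Iq ->].
      by exists (p + q); [apply: (idealD iP)|rewrite hornerD].
    by exists (p * q); [apply: (idealM iP)|rewrite hornerM].
  + by move=> [p Ip /esym p1]; apply: h; exists p.
- exact: adjoin_incl.
- move=> a Ia; exists a%:P; last by rewrite hornerC.
  by move=> i; rewrite coefC; case: eqP => _ //; apply: (ideal0 iI).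
- by apply: h1; apply: adjoin_gen.
Qed.

(* The relation of larger degree is shortened by eliminating its leading term with the other one. *)
Let no_two_relations N (p q : {poly F}) x : x != 0 -> (size p + size q <= N)%N ->
  polyin I p -> polyin I q -> p.[x] = 1 -> q.[x^-1] = 1 -> False.
Proof.
elim: N p q x => [|N IH] p q x x0 sN Ip Iq px qx.
  move: sN; rewrite leqn0 addn_eq0 size_poly_eq0 => /andP [/eqP p0 _].
  by move/eqP: px; rewrite p0 horner0 eq_sym oner_eq0.
wlog qp : p q x x0 sN Ip Iq px qx / (size q <= size p)%N.
  move=> h; case: (leqP (size q) (size p)) => [|/ltnW] pq; first exact: (h p q x).
  by apply: (h q p x^-1) => //; rewrite ?invr_eq0 ?invrK // addnC.
have q0 : q != 0 by apply/eqP => h; move/eqP: qx; rewrite h horner0 eq_sym oner_eq0.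
have p0 : p != 0 by apply/eqP => h; move/eqP: px; rewrite h horner0 eq_sym oner_eq0.
have /prednK sq : (0 < size q)%N by rewrite size_poly_gt0.
have /prednK sp : (0 < size p)%N by rewrite size_poly_gt0.
set b := (size q).-1 in sq; set a := (size p).-1 in sp.
have ba : (b <= a)%N by rewrite -ltnS sq sp.
have i0 : 1 - q`_0 != 0.
  apply/eqP => /eqP; rewrite subr_eq0 => /eqP h0; apply: I1.
  by rewrite h0; apply: Iq.
pose r := \poly_(j < b) ((1 - q`_0)^-1 * q`_(b - j)).
have Ir : polyin I r.
  move=> j; rewrite coef_poly; case: ifP => _; last exact: (ideal0 iI).
  by apply: (idealM iI) => //; apply: inv1p; apply: (idealN sV iI).
have rx : r.[x] = x ^+ b.
  move: qx; rewrite horner_coef -sq big_ord_recl expr0 mulr1 => qx.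
  have {}qx : \sum_(i < b) q`_(lift ord0 i) * x^-1 ^+ (lift ord0 i) = 1 - q`_0.
    by rewrite -qx addrC addKr.
  apply: (mulfI i0); rewrite -{2}qx horner_poly mulr_sumr mulr_suml.
  rewrite (reindex_inj rev_ord_inj); apply: eq_bigr => i _ /=.
  rewrite subKn // /bump leq0n add1n mulrA mulrA mulfV // mul1r -mulrA; congr (_ * _).
  have -> : x ^+ b = x ^+ (b - i.+1) * x ^+ i.+1 by rewrite -exprD subnK.
  by rewrite exprVn mulrC mulfK // expf_neq0.
(* The subtracted multiple of ['X^b - r] vanishes at [x] and cancels the leading term of [p], so the
   value 1 is kept and the size drops. *)
pose p' := p - (p`_a *: 'X^(a - b)) * ('X^b - r).
have p'x : p'.[x] = 1.
  by rewrite /p' !(hornerD, hornerN, hornerM, hornerXn) rx subrr mulr0 subr0.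
have iP := polyin_ideal sV iI.
have sP := polyin_subring sV.
have VX j : polyin V 'X^j.
  by move=> i; rewrite coefXn; case: eqP => _; [apply: subring1|apply: subring0].
have Ip' : polyin I p'.
  apply: (idealB sP iP) => //; rewrite mulrC; apply: (idealM iP).
    by apply: (subringB sP) => //; apply: (ideal_sub iP).
  by move=> i; rewrite coefZ mulrC; apply: (idealM iI) => //; apply: VX.
apply: (IH p' q x) => //.
rewrite -ltnS (leq_trans _ sN) // ltn_add2r -sp ltnS.
apply/leq_sizeP => j aj.
rewrite /p' coefB mulrBr coefB -!scalerAl -exprD subnK // !coefZ coefXn coefXnM coef_poly.
have [ja|ja] := eqVneq j a.
  by rewrite ja mulr1 ltnNge leq_subr /= subKn // ltnn mulr0 subr0 subrr.
have {aj}aj : (a < j)%N by rewrite ltn_neqAle eq_sym ja.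
have abj : (a - b <= j)%N := leq_trans (leq_subr _ _) (ltnW aj).
rewrite nth_default -?sp // mulr0 ltnNge abj /=.
have -> : (j - (a - b) < b)%N = false by apply/negbTE; rewrite -leqNgt leq_subRL // subnK // ltnW.
by rewrite !(subr0, mulr0).
Qed.

Lemma maximal_pair_valuation :
  (forall x, V x -> ~ I x -> V x^-1) /\ (forall x, B x -> ~ n x -> V x \/ V x^-1).
Proof.
split; first exact: unitV.
move=> x Bx nx; have [|Vx] := pselect (V x); first by left.
have [|Vx'] := pselect (V x^-1); first by right.
have x0 : x != 0 by apply/eqP => h; apply: nx; rewrite h; apply: (ideal0 in_).
have [p Ip px] := adjoin_unit Bx Vx.
have [q Iq qx] := adjoin_unit (unitB Bx nx) Vx'.
by case: (no_two_relations x0 (leqnn _) Ip Iq px qx).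
Qed.

End Maximal.

(* V/n is a valuation ring of the field B/n with a prime I/n above Q; keeping V inside B avoids forming
   the quotient B/n. *)
Lemma relative_valuation : exists V I : F -> Prop,
  [/\ is_subring V, is_ideal V I & ~ I 1] /\
  [/\ subset V B, subset S V, subset n I & subset Q I] /\
  (forall x, V x -> ~ I x -> V x^-1) /\ (forall x, B x -> ~ n x -> V x \/ V x^-1).
Proof.
have [M [gM baseM maxM]] := zorn_above good_base good_chain.
pose V x := M (x, true); pose I x := M (x, false).
have [sV VB iI I1] := gM.
have SV : subset S V.
  by move=> x Sx; apply: (baseM (x, true)); exists x, 0; rewrite addr0; split=> //; split=> //; apply: (ideal0 in_).
have QI : subset Q I.
  by move=> x Qx; apply: (baseM (x, false)); exists x, 0; rewrite addr0; split=> //; split=> //; apply: (ideal0 in_).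
have nI : subset n I.
  by move=> x nx; apply: (baseM (x, false)); exists 0, x; rewrite add0r; split=> //; apply: (ideal0 iQ).
exists V, I; do 2!split=> //; apply: maximal_pair_valuation => // V' I' g' VV' II'.
have h : subset (pair V' I') M.
  by apply: maxM => // -[x []] Mx; [apply: VV'|apply: II'].
by split=> x h'; [apply: (h (x, true))|apply: (h (x, false))].
Qed.

End RelativeValuation.

(** * Localization at a prime *)

Section Localization.
Variables (F : fieldType) (A P : F -> Prop).
Hypotheses (sA : is_subring A) (pP : is_prime A P).

Let iP : is_ideal A P. Proof. by case: pP. Qed.

Lemma prime_neq0 b : ~ P b -> b != 0.
Proof. by move=> nb; apply/eqP => h; apply: nb; rewrite h; apply: (ideal0 iP). Qed.

Lemma prime_compl1 : ~ P 1. Proof. by case: pP => _ []. Qed.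

Lemma prime_complM a b : A a -> A b -> ~ P a -> ~ P b -> ~ P (a * b).
Proof. by move=> Aa Ab na nb; case: pP => _ [_ h] /(h _ _ Aa Ab) []. Qed.

Lemma locid_incl (I : F -> Prop) x : I x -> locid A P I x.
Proof.
move=> Ix; exists x, 1; rewrite divr1; split=> //; split; first exact: subring1.
by split=> //; apply: prime_compl1.
Qed.

Lemma locid_mono (I J : F -> Prop) x : subset I J -> locid A P I x -> locid A P J x.
Proof. by move=> IJ [a [b [Ia h]]]; exists a, b; split=> //; apply: IJ. Qed.

Lemma locidP (I : F -> Prop) x : locid A P I x <-> exists b, A b /\ ~ P b /\ I (b * x).
Proof.
split.
  by move=> [a [b [Ia [Ab [nb ->]]]]]; exists b; rewrite mulrC divfK ?prime_neq0.
move=> [b [Ab [nb Ib]]]; exists (b * x), b; do 3!split=> //.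
by rewrite mulrC mulKf ?prime_neq0.
Qed.

Lemma loc_subring : is_subring (loc A P).
Proof.
split; first by apply: locid_incl; apply: subring0.
split; first by apply: locid_incl; apply: subring1.
split=> x y /locidP [b [Ab [nb Ax]]] /locidP [c [Ac [nc Ay]]]; apply/locidP; exists (b * c);
  (split; first exact: subringM); (split; first exact: prime_complM).
  rewrite (_ : _ * _ = c * (b * x) - b * (c * y)); last by ring.
  by apply: subringB => //; apply: subringM.
by rewrite (_ : _ * _ = (b * x) * (c * y)); [apply: subringM|ring].
Qed.

Lemma locid_ideal (I : F -> Prop) : is_ideal A I -> is_ideal (loc A P) (locid A P I).
Proof.
move=> iI; split; first by move=> x; apply: locid_mono; case: iI.
split; first by apply: locid_incl; apply: (ideal0 iI).
split=> x y /locidP [b [Ab [nb Ax]]] /locidP [c [Ac [nc Ay]]]; apply/locidP; exists (b * c);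
  (split; first exact: subringM); (split; first exact: prime_complM).
  rewrite (_ : _ * _ = c * (b * x) + b * (c * y)); last by ring.
  by apply: (idealD iI); apply: (idealM iI).
by rewrite (_ : _ * _ = (b * x) * (c * y)); [apply: (idealM iI)|ring].
Qed.

Lemma locid_unit x : loc A P x -> ~ locid A P P x -> loc A P x^-1.
Proof.
move=> [a [b [Aa [Ab [nb ->]]]]] nx; exists b, a; rewrite invf_div; do 3!split=> //.
by move=> Pa; apply: nx; exists a, b.
Qed.

Section SmallerPrime.
Variable p : F -> Prop.
Hypotheses (pp : is_prime A p) (pP' : subset p P).

Lemma locid_contract x : A x -> locid A P p x -> p x.
Proof.
move=> Ax /locidP [b [Ab [nb pbx]]]; case: pp => _ [_ /(_ b x Ab Ax pbx)] [] // pb.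
by case: nb; apply: pP'.
Qed.

Lemma locid_prime : is_prime (loc A P) (locid A P p).
Proof.
split; first by apply: locid_ideal; case: pp.
split; first by move/(locid_contract (subring1 sA)); case: pp => _ [].
move=> x y /locidP [b [Ab [nb Ax]]] /locidP [c [Ac [nc Ay]]] /locidP [d [Ad [nd pxy]]].
have : p (d * ((b * x) * (c * y))).
  rewrite (_ : _ * _ = (b * c) * (d * (x * y))); last by ring.
  by case: pp => ip _; apply: (idealM ip) => //; apply: subringM.
case: pp => ip [_ h] /h [] //; first by apply: subringM.
  by move/pP'.
by case/h => //; [left|right]; apply/locidP; [exists b|exists c].
Qed.

End SmallerPrime.
End Localization.

(** * Residue maps and coefficients of least value *)

Section Residue.
Variables (F : fieldType) (V I : F -> Prop) (kappa : fieldType) (rho : F -> kappa).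
Hypotheses (sV : is_subring V) (iI : is_ideal V I).
Hypotheses (rho1 : rho 1 = 1)
  (rhoD : forall x y, V x -> V y -> rho (x + y) = rho x + rho y)
  (rhoM : forall x y, V x -> V y -> rho (x * y) = rho x * rho y)
  (rho_eq0 : forall x, V x -> rho x = 0 <-> I x).

Lemma residue0 : rho 0 = 0.
Proof. by apply/rho_eq0; [apply: subring0|apply: (ideal0 iI)]. Qed.

Lemma residueB x y : V x -> V y -> rho (x - y) = rho x - rho y.
Proof.
move=> Vx Vy; have VB : V (x - y) by apply: subringB.
by apply/eqP; rewrite eq_sym subr_eq -rhoD // subrK.
Qed.

Lemma residue_sum (J : Type) (r : seq J) (f : J -> F) :
  (forall i, V (f i)) -> rho (\sum_(i <- r) f i) = \sum_(i <- r) rho (f i).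
Proof.
move=> Vf; elim: r => [|i r IH]; first by rewrite !big_nil residue0.
by rewrite !big_cons rhoD ?IH //; apply: subring_sum.
Qed.

Lemma residueX x n : V x -> rho (x ^+ n) = rho x ^+ n.
Proof.
move=> Vx; elim: n => [|n IH]; first by rewrite !expr0.
by rewrite !exprS rhoM ?IH //; apply: subringX.
Qed.

Lemma residue_monomial m d (y : 'I_m -> F) (e : {ffun 'I_m -> 'I_d}) :
  (forall i, V (y i)) -> rho (monomial y e) = monomial (fun i => rho (y i)) e.
Proof.
move=> Vy; rewrite /monomial; elim: (index_enum _) => [|i r IH]; first by rewrite !big_nil.
rewrite !big_cons rhoM ?residueX ?IH //; first exact: subringX.
by apply: subring_prod => // k _; apply: subringX.
Qed.

Lemma residue_horner (p : {poly F}) x : V x -> polyin V p ->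
  rho p.[x] = (\poly_(i < size p) rho p`_i).[rho x].
Proof.
move=> Vx Vp; rewrite horner_poly horner_coef residue_sum => [|i].
  by apply: eq_bigr => i _; rewrite rhoM ?residueX //; apply: subringX.
by apply: subringM => //; apply: subringX.
Qed.

Definition residue_image (X : F -> Prop) : kappa -> Prop := fun z => exists2 x, X x & z = rho x.

Lemma residue_image_subring (X : F -> Prop) :
  is_subring X -> subset X V -> is_subring (residue_image X).
Proof.
move=> sX XV; split; first by exists 0; [apply: subring0|rewrite residue0].
split; first by exists 1; [apply: subring1|rewrite rho1].
split=> _ _ [x Xx ->] [y Xy ->].
  by exists (x - y); [apply: subringB|rewrite residueB //; apply: XV].
by exists (x * y); [apply: subringM|rewrite rhoM //; apply: XV].
Qed.

Lemma indep_mod_residue (X : F -> Prop) m (y : 'I_m -> F) : subset X V ->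
  (forall i, V (y i)) -> indep_mod X I y ->
  indep_mod (residue_image X) zeroset (fun i => rho (y i)).
Proof.
move=> XV Vy iy d c Xc.
have /choice [x xP] : forall e, exists x, X x /\ c e = rho x by move=> e; case: (Xc e) => x; exists x.
have Vx e : V (x e) by case: (xP e) => /XV.
have Vm (e : {ffun 'I_m -> 'I_d}) : V (monomial y e) by apply: monomial_in.
rewrite /zeroset (_ : \sum_e _ = rho (\sum_e x e * monomial y e)); last first.
  rewrite residue_sum => [|e]; last exact: subringM.
  by apply: eq_bigr => e _; have [_ ->] := xP e; rewrite rhoM // residue_monomial.
have VS : V (\sum_e x e * monomial y e) by apply: subring_sum => // e _; apply: subringM.
move/(rho_eq0 VS) => h e; have [_ ->] := xP e; apply/rho_eq0 => //.
by apply: iy h e => e; case: (xP e).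
Qed.

End Residue.

Section RelativeResidue.
Variables (F : fieldType) (S Q' Q : F -> Prop).
Hypotheses (sS : is_subring S) (pQ' : is_prime S Q') (pQ : is_prime S Q).
Hypotheses (Q'Q : subset Q' Q) (unitS : forall x, S x -> ~ Q x -> S x^-1).

Let iQ' : is_ideal S Q'. Proof. by case: pQ'. Qed.
Let iQ : is_ideal S Q. Proof. by case: pQ. Qed.
Let B := loc S Q'.
Let n := locid S Q' Q'.

(** Here [S] is local with maximal ideal [Q], and [V] modulo [n] is a valuation ring of the residue
    field of [Q']. It dominates [S]: an element of [I] in [S] outside [Q] would be a unit of [S].
    The clause on finite families provides the member of least value, where the members of [Q']
    count as having infinite value. *)
Lemma relative_valuation_residue : exists (V I : F -> Prop) (kappa : fieldType) (rho : F -> kappa),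
  [/\ is_subring V, is_ideal V I, ~ I 1 & forall x, V x -> ~ I x -> V x^-1] /\
  [/\ subset S V, subset n I, forall x, S x -> I x <-> Q x &
      forall (J : finType) (c : J -> F) i0, (forall i, S (c i)) -> ~ Q' (c i0) ->
        exists i1, ~ Q' (c i1) /\ forall i, V (c i / c i1)] /\
  [/\ rho 1 = 1,
      forall x y, V x -> V y -> rho (x + y) = rho x + rho y,
      forall x y, V x -> V y -> rho (x * y) = rho x * rho y &
      forall x, V x -> rho x = 0 <-> I x].
Proof.
have SB : subset S B by move=> x; apply: locid_incl.
have [||||||||V [I [[sV iI I1] [[VB SV nI QI] [unitV valV]]]]] :=
  @relative_valuation F B n S Q.
- exact: loc_subring.
- exact: locid_ideal.
- by move=> x; apply: locid_unit.
- by [].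
- by [].
- by [].
- exact: prime_compl1 pQ.
- by move=> x Sx /(locid_contract pQ' pQ' (fun x h => h) Sx)/Q'Q.
have [kappa [rho rhoP]] := residue_field sV iI I1 unitV.
exists V, I, kappa, rho; split=> //; split=> //; split=> //.
  move=> x Sx; split=> [Ix|/QI//]; apply: contrapT => nQx; apply: I1.
  rewrite -(mulVf (prime_neq0 pQ nQx)); apply: (idealM iI) => //; exact/SV/unitS.
move=> J c i0 Sc nc0.
have nB x : S x -> ~ Q' x -> ~ n x.
  by move=> Sx nx /(locid_contract pQ' pQ' (fun x h => h) Sx).
have BV x : B x -> ~ Q' x -> S x -> B x^-1.
  by move=> Bx nx Sx; apply: locid_unit => //; apply: nB.
have Vratio i k : ~ Q' (c i) -> Q' (c k) -> V (c k / c i).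
  move=> nc Qc; apply: (ideal_sub iI); apply: nI; apply/locidP => //.
  by exists (c i); rewrite mulrC divfK // (prime_neq0 pQ').
(* The minimum is found by running through the list: [c i1] is the least member so far and is
   compared with each new [c k]. *)
suff h (s : seq J) : i0 \in s -> exists i1, ~ Q' (c i1) /\ forall i, i \in s -> V (c i / c i1).
  have [|i1 [nc1 h1]] := h (enum J); first by rewrite mem_enum.
  by exists i1; split=> // i; apply: h1; rewrite mem_enum.
move=> _; elim: s => [|k s [i1 [nc1 h1]]]; first by exists i0.
have [Qk|nk] := pselect (Q' (c k)).
  by exists i1; split=> // i; rewrite inE => /orP [/eqP -> | /h1 //]; apply: Vratio.
have c10 := prime_neq0 pQ' nc1; have ck0 := prime_neq0 pQ' nk.
have [] := valV (c k / c i1).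
- by apply: subringM; [apply: loc_subring|apply: SB|apply: BV => //; apply: SB].
- move=> /locidP -/(_ pQ') [b [Sb [nb Qb]]]; apply: (prime_complM pQ' Sb (Sc k) nb nk).
  rewrite (_ : _ * _ = c i1 * (b * (c k / c i1))); first exact: (idealM iQ').
  by rewrite mulrCA [c i1 * _]mulrC divfK.
- move=> h; exists i1; split=> // i; rewrite inE => /orP [/eqP -> // | /h1 //].
rewrite invf_div => h; exists k; split=> // i; rewrite inE => /orP [/eqP -> | /h1 {}h1].
  by rewrite divff //; apply: subring1.
rewrite (_ : _ / _ = (c i / c i1) * (c i1 / c k)); first exact: subringM.
by rewrite mulrA divfK.
Qed.

End RelativeResidue.

Section RingImage.
Variables (R : comNzRingType) (F : fieldType) (f : {rmorphism R -> F}).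
Variables (A I : R -> Prop).
Hypothesis sA : is_subring A.

Definition image_of (X : R -> Prop) : F -> Prop := fun z => exists2 a, X a & z = f a.

Lemma image_of_subring : is_subring (image_of A).
Proof.
split; first by exists 0; [apply: subring0|rewrite rmorph0].
split; first by exists 1; [apply: subring1|rewrite rmorph1].
split=> _ _ [x Xx ->] [y Xy ->].
  by exists (x - y); [apply: subringB|rewrite rmorphB].
by exists (x * y); [apply: subringM|rewrite rmorphM].
Qed.

Lemma image_of_prime : injective f -> is_prime A I -> is_prime (image_of A) (image_of I).
Proof.
move=> f_inj [iI [I1 pI]]; split; [split|split].
- by move=> _ [x Ix ->]; exists x => //; apply: (ideal_sub iI).
- split; first by exists 0; [apply: (ideal0 iI)|rewrite rmorph0].
  split=> [_ _ [x Ix ->] [y Iy ->]|_ _ [x Ax ->] [y Iy ->]].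
    by exists (x + y); [apply: (idealD iI)|rewrite rmorphD].
  by exists (x * y); [apply: (idealM iI)|rewrite rmorphM].
- by move=> [x Ix]; rewrite -(rmorph1 f) => /f_inj h; apply: I1; rewrite h.
- move=> _ _ [x Ax ->] [y Ay ->] [z Iz]; rewrite -rmorphM => /f_inj h.
  by have [|Ix|Iy] := pI x y Ax Ay; [rewrite h|left; exists x|right; exists y].
Qed.

End RingImage.

(** * Descent of independence to a smaller prime *)

Section Descent.
Variables (K F : fieldType) (j : {rmorphism K -> F}) (D : K -> Prop).
Variables (S Q' Q : F -> Prop).
Hypotheses (sD : is_subring D) (sS : is_subring S) (DS : forall a, D a -> S (j a)).
Hypotheses (pQ' : is_prime S Q') (pQ : is_prime S Q).
Hypotheses (Q'Q : subset Q' Q) (unitS : forall x, S x -> ~ Q x -> S x^-1).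

Hypothesis quasi_prufer_at : forall q : {poly K} -> Prop, is_prime (polyin D) q ->
  subset q (polyin (fun a => D a /\ Q (j a))) -> seteq q (polyin (fun a => D a /\ q a%:P)).

(** Let [q] be the kernel of the evaluation of D[X] at a / b in the residue field of [Q']. It
    contains bX - a but not the constant b, so it is not extended. By [quasi_prufer_at] it has a
    member with a coefficient outside [Q]; the reduction of this member modulo [I] is a nonzero
    equation for the residue of a / b. *)
Lemma residually_algebraic (V I : F -> Prop) (kappa : fieldType) (rho : F -> kappa) a b :
  is_subring V -> is_ideal V I -> subset S V -> subset (locid S Q' Q') I ->
  (forall x, S x -> I x <-> Q x) ->
  rho 1 = 1 -> (forall x y, V x -> V y -> rho (x + y) = rho x + rho y) ->
  (forall x y, V x -> V y -> rho (x * y) = rho x * rho y) ->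
  (forall x, V x -> rho x = 0 <-> I x) ->
  D a -> D b -> ~ Q' (j b) -> V (j a / j b) ->
  algebraic_over (residue_image rho (image_of j D)) (rho (j a / j b)).
Proof.
move=> sV iI SV nI IQ rho1 rhoD rhoM rho_eq0 Da Db nb Vab.
set d := j a / j b.
have iQ' : is_ideal S Q' by case: pQ'.
have sB := loc_subring sS pQ'.
have SB x : S x -> loc S Q' x by apply: locid_incl.
have pn := locid_prime sS pQ' pQ' (fun x h => h).
have in_ : is_ideal (loc S Q') (locid S Q' Q') by case: pn.
have Bd : loc S Q' d by exists (j a), (j b); split; [exact: DS|split; [exact: DS|by []]].
have jb0 := prime_neq0 pQ' nb.
have Bp p : polyin D p -> loc S Q' (map_poly j p).[d].
  by move=> Dp; apply: polyin_horner => // i; rewrite coef_map; apply/SB/DS.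
pose q p := polyin D p /\ locid S Q' Q' (map_poly j p).[d].
have sP := polyin_subring sD.
have pq : is_prime (polyin D) q.
  split; [split|split].
  - by move=> p [].
  - split; first by split; [apply: (subring0 sP)|rewrite rmorph0 horner0; apply: (ideal0 in_)].
    split=> [x y [Dx nx] [Dy ny]|x y Dx [Dy ny]].
      by split; [apply: (subringD sP)|rewrite rmorphD hornerD; apply: (idealD in_)].
    by split; [apply: (subringM sP)|rewrite rmorphM hornerM; apply: (idealM in_) => //; apply: Bp].
  - by move=> [_]; rewrite rmorph1 hornerC; apply: prime_compl1 pn.
  - move=> x y Dx Dy [_]; rewrite rmorphM hornerM => nxy.
    by case: pn => _ [_ /(_ _ _ (Bp _ Dx) (Bp _ Dy) nxy)] [?|?]; [left|right].
have [h|] := pselect (subset q (polyin (fun a => D a /\ Q (j a)))).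
  have /(quasi_prufer_at pq h)/(_ 1%N) : q (b *: 'X - a%:P).
    split.
      move=> i; rewrite coefB coefZ coefX coefC.
      by apply: subringB => //; [apply: subringM => //|]; case: eqP => _ //;
        try exact: subring0; apply: subring1.
    rewrite rmorphB /= map_polyZ map_polyX map_polyC hornerD hornerN hornerC hornerZ hornerX.
    by rewrite /= mulrC divfK // subrr; apply: (ideal0 in_).
  rewrite coefB coefZ coefX coefC /= mulr1 subr0 => -[_ [_]].
  by rewrite map_polyC hornerC /= => /(locid_contract pQ' pQ' (fun x h => h) (DS Db)).
move=> /existsNP [g] /not_implyP [[Dg ng]] /existsNP [i nQi].
have {}nQi : ~ Q (j g`_i) by move=> h; apply: nQi.
have Vjg : polyin V (map_poly j g) by move=> l; rewrite coef_map; apply/SV/DS.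
exists (\poly_(l < size (map_poly j g)) rho (map_poly j g)`_l).
  apply/eqP => /polyP /(_ i); rewrite coef0 coef_poly.
  case: ltnP => [_|hi _]; last first.
    apply: nQi; rewrite -coef_map nth_default //.
    by case: pQ => iQ _; apply: (ideal0 iQ).
  by rewrite coef_map => /rho_eq0 -/(_ (SV _ (DS (Dg i))))/IQ -/(_ (DS (Dg i))).
split.
  move=> l; rewrite coef_poly; case: ifP => _.
    by rewrite coef_map; exists (j g`_l) => //; exists g`_l.
  exists 0; last by rewrite (residue0 sV iI rho_eq0).
  by exists 0; [apply: subring0|rewrite rmorph0].
apply/rootP; rewrite -(residue_horner sV iI) //.
apply/rho_eq0; last exact: nI.
exact: polyin_horner.
Qed.

Lemma indep_mod_descent_local m (y : 'I_m -> F) : (forall i, S (y i)) ->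
  indep_mod (image_of j D) Q y -> indep_mod (image_of j D) Q' y.
Proof.
move=> Sy iy d c Dc Q's.
have [V [I [kappa [rho [[sV iI I1 unitV] [[SV nI IQ prim] [rho1 rhoD rhoM rho_eq0]]]]]]] :=
  relative_valuation_residue sS pQ' pQ Q'Q unitS.
have DS' : subset (image_of j D) S by move=> _ [a Da ->]; apply: DS.
have Vy i : V (y i) by apply: SV.
have sI : is_subring (residue_image rho (image_of j D)).
  by apply: (residue_image_subring sV iI) => //; [apply: image_of_subring|move=> x /DS'/SV].
apply: contrapT => /existsNP [e0 ne0].
have [|e1 [ne1 Ve]] := prim _ c e0 _ ne0; first by move=> e; apply/DS'.
have ce10 := prime_neq0 pQ' ne1.
have /indep_mod_algebraic -/(_ sI) indepV : indep_mod (residue_image rho (image_of j D)) zeroset (fun i => rho (y i)).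
  apply: (indep_mod_residue sV iI) => //; first by move=> x /DS'/SV.
  move=> d' c' Dc' Is e; apply/IQ; first exact/DS'.
  apply: (iy d' c' Dc') => //; apply/IQ => //.
  by apply: subring_sum => // e' _; apply: subringM; [|apply/DS'|apply: monomial_in].
have Vm (e : {ffun 'I_m -> 'I_d}) : V (monomial y e) by apply: monomial_in.
(* After the division the coefficient at [e1] is 1, whereas independence over the algebraic elements
   forces its residue to be 0. *)
have : zeroset (rho (c e1 / c e1)).
  apply: (indepV d (fun e => rho (c e / c e1))) => [e|].
    have [a Da ca] := Dc e; have [b Db cb] := Dc e1.
rewrite ca cb; apply: (residually_algebraic sV iI SV nI IQ) => //. all: rewrite -?ca -?cb //.
  rewrite /zeroset (_ : \sum_e _ = rho (\sum_e (c e / c e1) * monomial y e)); last first.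
    rewrite (residue_sum sV iI rhoD rho_eq0) => [|e]; last exact: subringM.
    by apply: eq_bigr => e _; rewrite [RHS]rhoM // (residue_monomial sV rho1 rhoM).
  apply/rho_eq0; first by apply: subring_sum => // e _; apply: subringM.
  apply: nI; apply/locidP => //; exists (c e1); split; first exact/DS'.
  split=> //; rewrite mulr_sumr (eq_bigr (fun e => c e * monomial y e)) // => e _.
  by rewrite mulrA [c e1 * _]mulrC divfK.
by rewrite /zeroset divff // rho1 => /eqP; rewrite oner_eq0.
Qed.

End Descent.

(** * Semistar operations *)

Section ExtendedSup.
Implicit Types (P : nat -> Prop).

(** [esup] is picked by [epsilon], so it satisfies its specification once a supremum is shown to
    exist: a least bound, or [None] for an unbounded set. *)
Lemma is_esup_esup P : is_esup P (esup P).
Proof.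
apply: ClassicalEpsilon.epsilon_spec.
have [[k Pk]|unb] := pselect (exists k, forall m, P m -> (m <= k)%N).
  have ex : exists k, `[<forall m, P m -> (m <= k)%N>] by exists k; apply/asboolP.
  exists (Some (ex_minn ex)); case: ex_minnP => n /asboolP Pn nmin; split=> // l Pl.
  by apply: nmin; apply/asboolP.
exists None => k; apply: contrapT => h; apply: unb; exists k => m Pm.
by rewrite leqNgt; apply/negP => km; apply: h; exists m.
Qed.

Lemma esup_ub P n m : esup P = Some n -> P m -> (m <= n)%N.
Proof. by move=> E; have := is_esup_esup P; rewrite E => -[h _] /h. Qed.

Lemma esup_attained P n m : esup P = Some n -> P m -> P n.
Proof.
move=> E Pm; have := is_esup_esup P; rewrite E => -[ub lub].
case: n E ub lub => [|n] E ub lub.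
  by have := ub _ Pm; rewrite leqn0 => /eqP <-.
apply: contrapT => nP; suff : (n.+1 <= n)%N by rewrite ltnn.
apply: lub => k Pk; rewrite -ltnS ltn_neqAle ub // andbT.
by apply/eqP => kn; apply: nP; rewrite -kn.
Qed.

Lemma esup_some P n : (forall m, P m -> (m <= n)%N) -> exists2 k, esup P = Some k & (k <= n)%N.
Proof.
move=> Pn; have := is_esup_esup P; case: (esup P) => [k [_ h]|h].
  by exists k => //; apply: h.
by have [m [/Pn mn]] := h n; rewrite ltnNge mn.
Qed.

(** Reduces an inequality between sums of suprema to single members. The members [a0] and [b0] make
    finite suprema on the left attained, and show that an infinite one would exceed any finite
    right-hand side. *)
Lemma ele_esup_add (A B C E : nat -> Prop) a0 b0 : A a0 -> B b0 ->
  (forall a b, A a -> B b -> exists c e, C c /\ E e /\ (a + b <= c + e)%N) ->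
  ele (eadd (esup A) (esup B)) (eadd (esup C) (esup E)).
Proof.
move=> Aa0 Bb0 h.
case Cc: (esup C) => [c|]; last by case: (eadd _ _).
case Ee: (esup E) => [e|]; last by case: (eadd _ _).
have ub a b : A a -> B b -> (a + b <= c + e)%N.
  move=> Aa Bb; have [c' [e' [Cc' [Ee' /leq_trans]]]] := h a b Aa Bb; apply.
  by apply: leq_add; [apply: esup_ub Cc Cc'|apply: esup_ub Ee Ee'].
case Aa: (esup A) => [a|]; last first.
  have := is_esup_esup A; rewrite Aa => /(_ (c + e)%N) [a [/ub /(_ Bb0) abce cea]].
  by have := leq_trans cea (leq_trans (leq_addr _ _) abce); rewrite ltnn.
case Bb: (esup B) => [b|]; last first.
  have := is_esup_esup B; rewrite Bb => /(_ (c + e)%N) [b [/(ub _ _ Aa0) abce ceb]].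
  by have := leq_trans ceb (leq_trans (leq_addl _ _) abce); rewrite ltnn.
by apply: ub; [apply: esup_attained Aa Aa0|apply: esup_attained Bb Bb0].
Qed.

End ExtendedSup.

Lemma seteq_eq (T : Type) (E G : T -> Prop) : seteq E G -> E = G.
Proof. by move=> h; apply/predeqP. Qed.

Section Generation.
Variables (K : fieldType) (A : K -> Prop).
Hypothesis sA : is_subring A.

Lemma gen_incl (G : K -> Prop) : subset G (gen A G).
Proof.
move=> x Gx; exists 1%N, (fun=> 1), (fun=> x); split; last by rewrite big_ord1 mul1r.
by move=> _; split=> //; apply: subring1.
Qed.

Lemma gen_closed (G : K -> Prop) : gen A G 0 /\
  (forall x y, gen A G x -> gen A G y -> gen A G (x + y)) /\
  (forall a x, A a -> gen A G x -> gen A G (a * x)).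
Proof.
split; first by exists 0%N, (fun=> 0), (fun=> 0); rewrite big_ord0; split=> // -[].
split=> [_ _ [n [a [g [h ->]]]] [m [b [e [h' ->]]]]|c _ Ac [n [a [g [h ->]]]]].
  exists (n + m)%N, (fun i => match split i with inl k => a k | inr k => b k end),
    (fun i => match split i with inl k => g k | inr k => e k end); split.
    by move=> i; case: (split i) => k.
  rewrite big_split_ord /=; congr (_ + _); apply: eq_bigr => i _.
    by rewrite (unsplitK (inl i)).
  by rewrite (unsplitK (inr i)).
exists n, (fun i => c * a i), g; split; first by move=> i; have [] := h i; split=> //; apply: subringM.
by rewrite mulr_sumr; apply: eq_bigr => i _; rewrite mulrA.
Qed.

Lemma gen_min (G E : K -> Prop) : E 0 -> (forall x y, E x -> E y -> E (x + y)) ->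
  (forall a x, A a -> E x -> E (a * x)) -> subset G E -> subset (gen A G) E.
Proof.
move=> E0 ED EM GE _ [n [a [g [h ->]]]]; elim/big_ind: _ => // i _.
by have [Aa /GE Eg] := h i; apply: EM.
Qed.

Lemma gen_submod (G : K -> Prop) : (exists x, G x /\ x != 0) -> submod A (gen A G).
Proof.
move=> [x [Gx x0]]; have [h0 [hD hM]] := gen_closed G.
by split; [exists x; split=> //; apply: gen_incl|].
Qed.

Lemma fgfrac_submod (G : K -> Prop) : fgfrac A G -> submod A G.
Proof.
by move=> [s [[x xs x0] /seteq_eq ->]]; apply: gen_submod; exists x.
Qed.

Lemma fgfrac_gen (s : seq K) x : x \in s -> x != 0 -> fgfrac A (gen A (fun z => z \in s)).
Proof. by move=> xs x0; exists s; split=> //; exists x. Qed.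

Lemma gen_sub (s : seq K) (E : K -> Prop) : submod A E -> (forall x, x \in s -> E x) ->
  subset (gen A (fun z => z \in s)) E.
Proof. by move=> [_ [E0 [ED EM]]]; apply: gen_min. Qed.

Lemma ideal_submod (I : K -> Prop) : is_ideal A I -> (exists x, I x /\ x != 0) -> submod A I.
Proof. by move=> [_ [I0 [ID IM]]]. Qed.

Lemma subring_submod : submod A A.
Proof.
split; first by exists 1; split; [apply: subring1|apply: oner_neq0].
by split; [apply: subring0|split=> ? ?; [apply: subringD|apply: subringM]].
Qed.

End Generation.

Section Semistar.
Variables (K : fieldType) (A : K -> Prop) (st : (K -> Prop) -> (K -> Prop)).
Hypotheses (sA : is_subring A) (sst : semistar A st).

Lemma semistar_submod E : submod A E -> submod A (st E).
Proof. by case: sst => h _; apply: h. Qed.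
Lemma semistar_scale x E : x != 0 -> submod A E -> seteq (st (scale x E)) (scale x (st E)).
Proof. by case: sst => _ [h _]; apply: h. Qed.
Lemma semistar_mono E G : submod A E -> submod A G -> subset E G -> subset (st E) (st G).
Proof. by case: sst => _ [_ [h _]]; apply: h. Qed.
Lemma semistar_ext E : submod A E -> subset E (st E).
Proof. by case: sst => _ [_ [_ h]] /h []. Qed.
Lemma semistar_idem E : submod A E -> subset (st (st E)) (st E).
Proof. by case: sst => _ [_ [_ h]] /h [_ e] x /e. Qed.

Lemma star_f_incl E : submod A E -> subset E (star_f A st E).
Proof.
move=> mE; have [[x [Ex x0]] _] := mE => y Ey.
have xs : x \in [:: x; y] by rewrite inE eqxx.
have fG := fgfrac_gen A xs x0.
exists (gen A (fun z => z \in [:: x; y])); split=> //; split.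
  by apply: gen_sub => // z; rewrite !inE => /orP [] /eqP ->.
apply: semistar_ext; first exact: fgfrac_submod fG.
by apply: gen_incl => //; rewrite !inE eqxx orbT.
Qed.

(** Joining the generators of two finitely generated submodules of [E] gives another one, whose
    closure contains both closures. *)
Lemma star_f_directed E (s : seq K) : submod A E -> (forall x, x \in s -> star_f A st E x) ->
  exists G, fgfrac A G /\ subset G E /\ forall x, x \in s -> st G x.
Proof.
move=> mE; elim: s => [|y s IH] h.
  have [[x [Ex x0]] _] := mE; exists (gen A (fun z => z \in [:: x])).
  split; first by apply: (fgfrac_gen A (x := x)) => //; rewrite inE.
  by split=> // ; apply: gen_sub => // z; rewrite inE => /eqP ->.
have [|G1 [fG1 [G1E G1s]]] := IH; first by move=> x xs; apply: h; rewrite inE xs orbT.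
have [|G2 [fG2 [G2E G2y]]] := h y; first by rewrite inE eqxx.
have [mG1 mG2] := (fgfrac_submod sA fG1, fgfrac_submod sA fG2).
have [s1 [[x1 xs1 x10] /seteq_eq G1D]] := fG1; have [s2 [_ /seteq_eq G2D]] := fG2.
have xs12 : x1 \in s1 ++ s2 by rewrite mem_cat xs1.
have fG := fgfrac_gen A xs12 x10; have mG := fgfrac_submod sA fG.
exists (gen A (fun z => z \in s1 ++ s2)); split=> //; split.
  apply: gen_sub => // z; rewrite mem_cat => /orP [] zs.
    by apply: G1E; rewrite G1D; apply: gen_incl.
  by apply: G2E; rewrite G2D; apply: gen_incl.
move=> x; rewrite inE => /orP [/eqP ->|xs].
  apply: (semistar_mono mG2 mG) => //; rewrite G2D; apply: gen_sub => // z zs.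
  by apply: gen_incl => //; rewrite mem_cat zs orbT.
apply: (semistar_mono mG1 mG); last exact: G1s.
by rewrite G1D; apply: gen_sub => // z zs; apply: gen_incl => //; rewrite mem_cat zs.
Qed.

(** The generators of [G] all lie in the closure of a single [H], which is closed; hence it contains
    the closure of [G]. *)
Lemma star_f_idem E G : submod A E -> fgfrac A G -> subset G (star_f A st E) ->
  subset (st G) (star_f A st E).
Proof.
move=> mE fG GE y sGy; have mG := fgfrac_submod sA fG.
have [s [_ /seteq_eq GD]] := fG.
have [|H [fH [HE Hs]]] := @star_f_directed E s mE.
  by move=> x xs; apply: GE; rewrite GD; apply: gen_incl.
have mH := fgfrac_submod sA fH; have mstH := semistar_submod mH.
exists H; split=> //; split=> //; apply: semistar_idem => //.
by apply: (semistar_mono mG mstH) sGy; rewrite GD; apply: gen_sub.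
Qed.

Lemma star_f_submod E : submod A E -> submod A (star_f A st E).
Proof.
move=> mE; have incl := star_f_incl mE.
split; first by have [[x [Ex x0]] _] := mE; exists x; split=> //; apply: incl.
split; first by apply: incl; case: mE => _ [].
split=> [x y Ex Ey|a x Aa Ex].
  have [|G [fG [GE Gs]]] := @star_f_directed E [:: x; y] mE.
    by move=> z; rewrite !inE => /orP [] /eqP ->.
  exists G; split=> //; split=> //.
  have [_ [_ [h _]]] := semistar_submod (fgfrac_submod sA fG).
  by apply: h; apply: Gs; rewrite !inE eqxx ?orbT.
have [G [fG [GE Gx]]] := Ex; exists G; split=> //; split=> //.
by have [_ [_ [_ h]]] := semistar_submod (fgfrac_submod sA fG); apply: h.
Qed.

Lemma star_f_qideal I : is_ideal A I -> (exists x, I x /\ x != 0) ->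
  qideal A (star_f A st) (fun y => A y /\ star_f A st I y).
Proof.
move=> iI nzI; have mI := ideal_submod iI nzI.
have [_ [m0 [mD mM]]] := star_f_submod mI.
have iJ : is_ideal A (fun y => A y /\ star_f A st I y).
  split; first by move=> x [].
  split; first by split=> //; apply: subring0.
  split=> [x y [Ax Ix] [Ay Iy]|a x Aa [Ax Ix]]; split.
  - exact: subringD.
  - exact: mD.
  - exact: subringM.
  - exact: mM.
have nzJ : exists x, (A x /\ star_f A st I x) /\ x != 0.
  have [x [Ix x0]] := nzI; exists x; split=> //; split; first exact: (ideal_sub iI).
  exact: star_f_incl.
split=> //; split=> // y; split; last first.
  by move=> [Ay Iy]; split=> //; apply: star_f_incl => //; apply: ideal_submod.
move=> [[G [fG [GJ Gy]]] Ay]; split=> //; apply: (star_f_idem mI fG) Gy.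
by move=> z /GJ [].
Qed.

Section QuasiMaximal.
Variable M : K -> Prop.
Hypothesis qM : qmax A (star_f A st) M.

Lemma qmax_ideal : is_ideal A M. Proof. by case: qM => -[]. Qed.
Lemma qmax1 : ~ M 1. Proof. by case: qM => _ []. Qed.
Lemma qmax_nonzero : exists x, M x /\ x != 0. Proof. by case: qM => -[_ []]. Qed.
Lemma qmax_star_f x : A x -> star_f A st M x -> M x.
Proof. by case: qM => -[_ [_ h]] _ Ax sx; apply/h. Qed.

(* If a is outside M, then 1 lies in G* for a finitely generated G inside M + aA; multiplying by b
   gives bG inside M, hence b in M. *)
Lemma qmax_prime : is_prime A M.
Proof.
have iM := qmax_ideal; split=> //; split; first exact: qmax1.
move=> a b Aa Ab Mab; have [|na] := pselect (M a); [by left|right].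
pose I : K -> Prop := fun x => exists m r, M m /\ A r /\ x = m + r * a.
have iI : is_ideal A I.
  split; first by move=> _ [m [r [Mm [Ar ->]]]]; apply: subringD; [|apply: (ideal_sub iM)|apply: subringM].
  split; first by exists 0, 0; rewrite mul0r addr0; split; [apply: (ideal0 iM)|split=> //; apply: subring0].
  split=> [_ _ [m [r [Mm [Ar ->]]]] [l [s [Ml [As ->]]]]|c _ Ac [m [r [Mm [Ar ->]]]]].
    exists (m + l), (r + s); split; first exact: (idealD iM).
    by split; [apply: subringD|ring].
  exists (c * m), (c * r); split; first exact: (idealM iM).
  by split; [apply: subringM|ring].
have MI : subset M I by move=> m Mm; exists m, 0; rewrite mul0r addr0; split=> //; split=> //; apply: subring0.
have nzI : exists x, I x /\ x != 0 by have [x [/MI Ix x0]] := qmax_nonzero; exists x.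
have Ia : I a.
  by exists 0, 1; rewrite mul1r add0r; split; [apply: (ideal0 iM)|split=> //; apply: subring1].
have mI := ideal_submod iI nzI.
have qJ := star_f_qideal iI nzI.
have [[_ [G [fG [GI G1]]]]|nJ1] := pselect (A 1 /\ star_f A st I 1); last first.
  case: na; case: qM => _ [_ /(_ _ qJ nJ1)]; apply.
    by move=> x Mx; split; [apply: (ideal_sub iM)|apply: star_f_incl => //; apply: MI].
  by split=> //; apply: star_f_incl.
have [->|b0] := eqVneq b 0; first exact: (ideal0 iM).
have mG := fgfrac_submod sA fG.
have GM x : G x -> M (b * x).
  move=> /GI [m [r [Mm [Ar ->]]]]; rewrite mulrDr; apply: (idealD iM); first exact: (idealM iM).
  by rewrite (_ : b * _ = r * (a * b)); [apply: (idealM iM)|ring].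
have [s [[x xs x0] /seteq_eq GD]] := fG.
pose s' := [seq b * z | z <- s].
have xs' : b * x \in s' by apply: map_f.
have fG' := fgfrac_gen A xs' (mulf_neq0 b0 x0).
have mM := ideal_submod iM qmax_nonzero.
apply: qmax_star_f => //; exists (gen A (fun z => z \in s')); split=> //; split.
  apply: gen_sub => // z /mapP [w ws ->]; apply: GM; rewrite GD; exact: gen_incl.
have GE : seteq (gen A (fun z => z \in s')) (scale b G).
  have [g0 [gD gM]] := gen_closed sA (fun z => z \in s').
  move=> y; split; last first.
    move=> [e [Ge ->]]; move: e Ge; rewrite GD; apply: gen_min => //.
    - by rewrite mulr0.
    - by move=> u v hu hv; rewrite mulrDr; apply: gD.
    - by move=> c u Ac hu; rewrite mulrCA; apply: gM.
    - by move=> z zs; apply: gen_incl => //; apply: map_f.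
  case: mG => _ [G0 [GD' GM']]; move: y; apply: gen_min => //.
  - by exists 0; rewrite mulr0.
  - by move=> _ _ [u [Gu ->]] [v [Gv ->]]; exists (u + v); rewrite mulrDr; split=> //; apply: GD'.
  - by move=> c _ Ac [u [Gu ->]]; exists (c * u); rewrite mulrCA; split=> //; apply: GM'.
  - by move=> _ /mapP [w ws ->]; exists w; split=> //; rewrite GD; apply: gen_incl.
rewrite (seteq_eq GE); apply/semistar_scale => //; exists 1; rewrite mulr1; split=> //.
Qed.

(** If y is in [A] and in the extension of [p] to the localization at [M], then b * y is in [p] for
    some b outside [M], hence outside [p], so y is in [p]. Testing the single ideal [M] is
    enough. *)
Lemma qprime_tilde_sub_qmax p : is_prime A p -> (exists x, p x /\ x != 0) -> subset p M ->
  qprime A (st_tilde A st) p.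
Proof.
move=> pp nzp pM; split=> //; case: (pp) => ip [p1 pr]; split=> //; split=> // y; split.
  move=> [/(_ _ qM) [a [b [pa [Ab [nb yE]]]]] Ay].
  have b0 : b != 0 by apply: (prime_neq0 qmax_prime).
  have : p (b * y) by rewrite yE mulrC divfK.
  by case/pr => // /pM.
move=> py; split; last exact: (ideal_sub ip).
by move=> N [[iN _] [N1 _]]; exists y, 1; rewrite divr1; split=> //; split=> //; apply: subring1.
Qed.

End QuasiMaximal.

(** Zorn's lemma above the quasi-ideal generated by [I]. The union of a chain of quasi-ideals is one
    because the closure has finite type: a finitely generated [G] inside the union is inside one
    member. *)
Lemma exists_qmax I : is_ideal A I -> (exists x, I x /\ x != 0) -> ~ star_f A st I 1 ->
  exists2 M, qmax A (star_f A st) M & subset I M.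
Proof.
move=> iI nzI nI1.
have qJ := star_f_qideal iI nzI.
have mI := ideal_submod iI nzI.
pose good J := qideal A (star_f A st) J /\ ~ J 1.
have gJ : good (fun y => A y /\ star_f A st I y) by split=> // -[].
have [C [X0 CX0] Cg Ctot|M [[qM M1] JM Mmax]] := zorn_above gJ.
  have two a b : (exists2 X, C X & X a) -> (exists2 X, C X & X b) ->
      exists X, C X /\ X a /\ X b.
    move=> [X CX Xa] [Y CY Yb]; case: (Ctot X Y CX CY) => h.
      by exists Y; split=> //; split=> //; apply: h.
    by exists X; split=> //; split=> //; apply: h.
  have iC X : C X -> is_ideal A X by move=> /Cg [[]].
  split; last by move=> [X /Cg [_ nX]].
  split; [split|split].
  - by move=> x [X /iC iX Xx]; apply: (ideal_sub iX).
  - split; first by exists X0 => //; apply: (ideal0 (iC _ CX0)).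
    split=> [x y hx hy|a x Aa [X CX Xx]]; last by exists X => //; apply: (idealM (iC _ CX)).
    by have [X [CX [Xx Xy]]] := two _ _ hx hy; exists X => //; apply: (idealD (iC _ CX)).
  - by have [[_ [[x [Xx x0]] _]] _] := Cg _ CX0; exists x; split=> //; exists X0.
  - move=> y; split; last first.
      move=> [X CX Xy]; have [[_ [nzX h]] _] := Cg _ CX.
      have Ay := ideal_sub (iC _ CX) Xy; split=> //.
      have /h [[G [fG [GX Gy]]] _] := Xy.
      by exists G; split=> //; split=> // z /GX; exists X.
    move=> [[G [fG [GC Gy]]] Ay].
    have [s [_ /seteq_eq GD]] := fG.
    have [X [CX Xs]] : exists X, C X /\ forall x, x \in s -> X x.
      have : forall x, x \in s -> exists2 X, C X & X x.
        by move=> x xs; apply: GC; rewrite GD; apply: gen_incl.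
      elim: (s) => [|x t IH] h; first by exists X0.
      have [|X [CX Xt]] := IH; first by move=> z zt; apply: h; rewrite inE zt orbT.
      have [|Y CY Yx] := h x; first by rewrite inE eqxx.
      case: (Ctot X Y CX CY) => XY.
        by exists Y; split=> // z; rewrite inE => /orP [/eqP -> //|/Xt/XY].
      by exists X; split=> // z; rewrite inE => /orP [/eqP ->|/Xt //]; apply: XY.
    have [[iX [nzX h]] _] := Cg _ CX.
    exists X => //; apply/h; split=> //; exists G; split=> //; split=> //.
    by rewrite GD; apply: gen_sub => //; apply: ideal_submod.
exists M; last by move=> x Ix; apply: JM; split; [apply: (ideal_sub iI)|apply: star_f_incl].
by split=> //; split=> // J qJ' J1 MJ; apply: Mmax.
Qed.

(** If [P] were in no quasi-maximal [M], it would extend to the unit ideal in every localization,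
    and 1 would lie in its tilde closure. *)
Lemma sub_qmax_of_qprime_tilde P : qprime A (st_tilde A st) P ->
  exists2 M, qmax A (star_f A st) M & subset P M.
Proof.
move=> [[iP [nzP h]] [_ [P1 _]]]; apply: contrapT => nM; apply: P1; apply/h.
split; last exact: subring1.
move=> M qM; have /existsNP [x /not_implyP [Px nMx]] : ~ subset P M by move=> PM; apply: nM; exists M.
have x0 := prime_neq0 (qmax_prime qM) nMx.
by exists x, x; split=> //; split; [apply: (ideal_sub iP)|rewrite divff].
Qed.

(** This exploits the side condition of the dimension inequality: an ideal inside no quasi-maximal
    ideal has the same tilde closure as the ring. *)
Lemma sub_qmax_of_ssub q : is_ideal A q -> ssub (st_tilde A st q) (st_tilde A st A) ->
  exists2 M, qmax A (star_f A st) M & subset q M.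
Proof.
move=> iq [_ [x [xA xq]]]; apply: contrapT => nM; apply: xq => M qM.
have /existsNP [s /not_implyP [qs nMs]] : ~ subset q M by move=> PM; apply: nM; exists M.
have [a [b [Aa [Ab [nb ->]]]]] := xA M qM.
have pM := qmax_prime qM; have As := ideal_sub iq qs.
exists (a * s), (b * s); split; first exact: (idealM iq).
split; first exact: subringM.
split; first exact: (prime_complM pM).
by rewrite -mulf_div divff ?mulr1 // (prime_neq0 pM).
Qed.

End Semistar.

(** The contraction of [N] is nonzero, since it contains numerators of elements of [N]. If its
    finite type closure contained 1, some finitely generated [G] in it would have the closure of
    [D]; by linkedness 1 would be in the closure of [gen T G], which lies in [N]. *)
Lemma linked_contract_qmax (K : fieldType) (D T : K -> Prop) st st' N :
  is_domain D -> is_subring T -> subset D T -> semistar D st -> semistar T st' ->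
  linked D st T st' -> qmax T (star_f T st') N ->
  exists2 M, qmax D (star_f D st) M & subset (fun x => D x /\ N x) M.
Proof.
move=> [sD fD] sT DT sst sst' lT qN; have iN := qmax_ideal qN.
have iI : is_ideal D (fun x => D x /\ N x).
  split; first by move=> x [].
  split; first by split; [apply: subring0|apply: (ideal0 iN)].
  split=> [x y [Dx Nx] [Dy Ny]|a x Da [Dx Nx]].
    by split; [apply: subringD|apply: (idealD iN)].
  by split; [apply: subringM|apply: (idealM iN) => //; apply: DT].
have nzI : exists x, (D x /\ N x) /\ x != 0.
  have [x [Nx x0]] := qmax_nonzero qN; have [a [b [Da [Db [b0 xE]]]]] := fD x.
  have aE : a = b * x by rewrite xE mulrC divfK.
  exists a; rewrite {3}aE mulf_neq0 //; split=> //; split=> //.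
  by rewrite aE; apply: (idealM iN) => //; apply: DT.
apply: exists_qmax => // -[G [fG [GI G1]]].
have mG := fgfrac_submod sD fG; have mD := subring_submod sD.
have GD : subset G D by move=> x /GI [].
have GN : subset G N by move=> x /GI [].
(* As 1 is in the closure of [G], so is all of [D]; the closure of [D] follows by idempotence. *)
have stGD : seteq (st G) (st D).
  move=> x; split; first exact: (semistar_mono sst mG mD).
  move=> Dx; apply: (semistar_idem sst mG).
  apply: (semistar_mono sst mD (semistar_submod sst mG)) Dx.
  have [_ [_ [_ h]]] := semistar_submod sst mG.
  by move=> y Dy; rewrite -[y]mulr1; apply: h.
have /seteq_eq eT := lT G fG GD stGD.
have [s [[x xs x0] /seteq_eq GsE]] := fG.
have fT : fgfrac T (gen T G).
  exists s; split; first by exists x.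
  have [g0 [gD gM]] := gen_closed sT G; have [h0 [hD hM]] := gen_closed sT (fun z => z \in s).
  move=> y; split; move: y; apply: gen_min => // y.
    rewrite GsE; move: y; apply: gen_min => // [a y Da|y ys]; last exact: gen_incl.
    by apply: hM; apply: DT.
  by move=> ys; apply: gen_incl => //; rewrite GsE; apply: gen_incl.
apply: (qmax1 qN); apply: (qmax_star_f qN); first exact: subring1.
exists (gen T G); split=> //; split.
  by apply: gen_min => //; case: iN => _ [? []].
rewrite eT; apply: (semistar_ext sst' (subring_submod sT)); exact: subring1.
Qed.

(** * Localization at a prime as a semistar operation *)

Section LocalizationStar.
Variables (K : fieldType) (T q : K -> Prop).
Hypotheses (sT : is_subring T) (pq : is_prime T q) (nzq : exists x, q x /\ x != 0).

Let iq : is_ideal T q. Proof. by case: pq. Qed.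

Lemma semistar_locid : semistar T (locid T q).
Proof.
have nb0 b : ~ q b -> b != 0 := @prime_neq0 _ _ _ pq b.
split.
  move=> E [[x [Ex x0]] [E0 [ED EM]]].
  split; first by exists x; split=> //; apply: locid_incl.
  split; first exact: locid_incl.
  split=> [y z /(locidP pq) [b [Ab [nb Ay]]] /(locidP pq) [c [Ac [nc Az]]]|
           a y Ta /(locidP pq) [b [Ab [nb Ay]]]].
    apply/(locidP pq); exists (b * c); split; first exact: subringM.
    split; first exact: (prime_complM pq).
    by rewrite (_ : _ * _ = c * (b * y) + b * (c * z)); [apply: ED; apply: EM|ring].
  by apply/(locidP pq); exists b; rewrite mulrCA; do 2!split=> //; apply: EM.
split.
  move=> x E x0 _ y; split.
    move=> /(locidP pq) [b [Tb [nb [e [Ee h]]]]]; exists (x^-1 * y).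
    split; last by rewrite mulVKf.
    by apply/(locidP pq); exists b; rewrite mulrCA h mulKf.
  move=> [e [/(locidP pq) [b [Tb [nb Ee]]] ->]]; apply/(locidP pq); exists b; do 2!split=> //.
  by exists (b * e); rewrite mulrCA.
split; first by move=> E G _ _ EG y; apply: locid_mono.
move=> E mE; split; first by move=> y; apply: locid_incl.
move=> y; split; last by apply: locid_incl.
move=> /(locidP pq) [b [Tb [nb /(locidP pq) [c [Tc [nc Ey]]]]]]; apply/(locidP pq).
exists (c * b); split; first exact: subringM.
by split; [apply: (prime_complM pq)|rewrite -mulrA].
Qed.

(** A quasi-ideal with an element x outside [q] contains 1, because 1 = x / x is in the extension of
    xT to the localization. *)
Lemma qmax_locid : qmax T (star_f T (locid T q)) q.
Proof.
have mq := ideal_submod iq nzq.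
split; [split=> //; split=> // y; split|split].
- by move=> [[G [_ [Gq Gy]]] Ty]; apply: (locid_contract pq pq (fun x h => h) Ty); apply: locid_mono Gy.
- move=> qy; split; last exact: (ideal_sub iq).
  by apply: star_f_incl => //; apply: semistar_locid.
- exact: prime_compl1 pq.
move=> J [iJ [_ hJ]] J1 qJ x Jx; apply: contrapT => nqx; apply: J1; apply/hJ.
have x0 := prime_neq0 pq nqx; have Tx := ideal_sub iJ Jx.
split; last exact: subring1.
have xs : x \in [:: x] by rewrite inE.
exists (gen T (fun z => z \in [:: x])); split; first exact: (fgfrac_gen T xs).
split.
  apply: gen_sub => //; first by apply: ideal_submod => //; exists x.
  by move=> z; rewrite inE => /eqP ->.
by exists x, x; rewrite divff //; split; first exact: gen_incl.
Qed.

(** A finitely generated ideal with the closure of [D] is not inside the quasi-maximal [M], so it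
    has an element outside [q], which is a unit in the localization. *)
Lemma linked_locid (D : K -> Prop) st M : semistar D st -> is_subring D -> subset D T ->
  qmax D (star_f D st) M -> subset (fun x => D x /\ q x) M -> linked D st T (locid T q).
Proof.
move=> sst sD DT qM PM G fG GD /seteq_eq eG.
have [x [Gx nqx]] : exists x, G x /\ ~ q x.
  apply: contrapT => h; apply: (qmax1 qM); apply: (qmax_star_f qM); first exact: subring1.
  exists G; split=> //; split.
    by move=> x Gx; apply: PM; split; [apply: GD|apply: contrapT => nq; apply: h; exists x].
  by rewrite eG; apply: (semistar_ext sst (subring_submod sD)); apply: subring1.
have Tx := DT _ (GD _ Gx).
move=> y; split.
  apply: locid_mono; apply: gen_min => //; first exact: subring0.
  - by move=> ? ?; apply: subringD.
  - by move=> ? ?; apply: subringM.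
  - by move=> z /GD/DT.
move=> /(locidP pq) [b [Tb [nb Ty]]]; apply/(locidP pq); exists (b * x).
split; first exact: subringM.
split; first exact: (prime_complM pq).
have [_ [_ gM]] := gen_closed sT G.
by rewrite mulrAC; apply: gM => //; apply: gen_incl.
Qed.

End LocalizationStar.

(** * The dimension inequality formula *)

Lemma zeroset_prime (K : fieldType) (A : K -> Prop) : is_subring A -> is_prime A zeroset.
Proof.
move=> sA; split; [split|split].
- by move=> _ ->; apply: subring0.
- split=> //; split=> [_ _ -> ->|a _ _ ->]; first by rewrite /zeroset addr0.
  by rewrite /zeroset mulr0.
- by apply/eqP; apply: oner_neq0.
- by move=> a b _ _ /eqP; rewrite mulf_eq0 => /orP [] /eqP; [left|right].
Qed.

Lemma prime_preimage (K F : fieldType) (j : {rmorphism K -> F}) (T : K -> Prop) (S P : F -> Prop) :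
  is_subring T -> (forall x, T x -> S (j x)) -> is_prime S P ->
  is_prime T (fun x => T x /\ P (j x)).
Proof.
move=> sT TS [iP [P1 pP]]; split; [split|split].
- by move=> x [].
- split; first by split; [apply: subring0|rewrite rmorph0; apply: (ideal0 iP)].
  split=> [x y [Tx Px] [Ty Py]|a x Ta [Tx Px]].
    by split; [apply: subringD|rewrite rmorphD; apply: (idealD iP)].
  by split; [apply: subringM|rewrite rmorphM; apply: (idealM iP) => //; apply: TS].
- by move=> [_]; rewrite rmorph1.
- move=> a b Ta Tb [_]; rewrite rmorphM => /pP [||?|?]; try exact: TS; by [left|right].
Qed.

Lemma ssub_nonzero (K : fieldType) (p q : K -> Prop) : p 0 -> ssub p q -> exists x, q x /\ x != 0.
Proof. by move=> p0 [_ [x [qx px]]]; exists x; split=> //; apply: contra_notN px => /eqP ->. Qed.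

Lemma qchain_zero (K : fieldType) (A p : K -> Prop) st : seteq p zeroset -> qchain A st p 0.
Proof. by move=> h; exists (fun=> p); split=> //; split=> //; split=> // -[]. Qed.

Lemma qchain_extend (K : fieldType) (A p q : K -> Prop) st n :
  qchain A st p n -> qprime A st q -> ssub p q -> qchain A st q n.+1.
Proof.
move=> [c [c0 [/seteq_eq cn [cq cs]]]] qq pq.
exists (fun i => if (i <= n)%N then c i else q); split=> //; split; first by rewrite ltnn.
split=> i; first by case: ifP => [ile /andP [i0 _]|//]; apply: cq; rewrite i0.
rewrite ltnS => ile; rewrite ile; case: ltngtP ile => // [il _|-> _]; first exact: cs.
by rewrite cn.
Qed.

Lemma qchain_single (K : fieldType) (A p : K -> Prop) st : qprime A st p -> qchain A st p 1.
Proof.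
move=> qp; have [[ip [[x [px x0]] _]] _] := qp.
have c0 : qchain A st zeroset 0 by apply: qchain_zero.
apply: (qchain_extend c0 qp); split; first by move=> z ->; apply: (ideal0 ip).
by exists x; split=> //; apply/eqP.
Qed.

(** Localizing [S] at [Q] provides the units that the local version asks for; both primes contract
    back to themselves. *)
Lemma indep_mod_descent (K F : fieldType) (j : {rmorphism K -> F}) (D : K -> Prop)
  (S Q' Q : F -> Prop) m (y : 'I_m -> F) :
  is_subring D -> is_subring S -> (forall a, D a -> S (j a)) ->
  is_prime S Q' -> is_prime S Q -> subset Q' Q ->
  (forall q : {poly K} -> Prop, is_prime (polyin D) q ->
     subset q (polyin (fun a => D a /\ Q (j a))) -> seteq q (polyin (fun a => D a /\ q a%:P))) ->
  (forall i, S (y i)) -> indep_mod (image_of j D) Q y -> indep_mod (image_of j D) Q' y.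
Proof.
move=> sD sS DS pQ' pQ Q'Q qp Sy iy d c Dc Q's.
have QQ : subset Q Q by [].
have iS x : S x -> loc S Q x := @locid_incl _ _ _ sS pQ _ x.
have DSc e : S (c e) by case: (Dc e) => a Da ->; apply: DS.
have h := @indep_mod_descent_local K F j D (loc S Q) (locid S Q Q') (locid S Q Q) sD
  (loc_subring sS pQ) (fun a Da => iS _ (DS a Da)) (locid_prime sS pQ pQ' Q'Q)
  (locid_prime sS pQ pQ QQ) (fun x => @locid_mono _ S Q Q' Q x Q'Q)
  (@locid_unit _ S Q).
move=> e; apply: (locid_contract pQ pQ' Q'Q (DSc e)); move: e.
apply: (h _ m y (fun i => iS _ (Sy i)) _ d c Dc); last exact: locid_incl.
  move=> q pq qP; apply: qp => // p /qP Pp i; have [Da Qa] := Pp i; split=> //.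
  by apply: (locid_contract pQ pQ QQ) => //; apply: DS.
move=> d' c' Dc' Qs' e; apply: locid_incl => //; apply: (iy d' c' Dc' _ e).
have DSc' e' : S (c' e') by case: (Dc' e') => a Da ->; apply: DS.
apply: (locid_contract pQ pQ QQ) => //; apply: subring_sum => // e' _.
by apply: subringM => //; apply: monomial_in.
Qed.

Section DimensionInequality.
Variables (K F : fieldType) (j : {rmorphism K -> F}) (D T : K -> Prop) (S : F -> Prop).
Variable (st : (K -> Prop) -> (K -> Prop)).
Hypotheses (dD : is_domain D) (DT : subset D T) (sT : is_subring T) (sS : is_subring S).
Hypothesis (TS : forall x, T x -> S (j x)).

Let sD : is_subring D. Proof. by case: dD. Qed.
Let DS a : D a -> S (j a). Proof. by move/DT; apply: TS. Qed.

Lemma alg_indep_of_indep_mod m (y : 'I_m -> F) :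
  indep_mod (image_of j D) zeroset y -> alg_indep j y.
Proof.
move=> iy d c h e.
have /(_ d (fun e => j (c e))) := indep_mod_fracs (image_of_subring j sD) iy.
have fc e' : fracs (image_of j D) (j (c e')).
  have [_ /(_ (c e')) [a [b [Da [Db [b0 ->]]]]]] := dD.
  exists (j a), (j b); split; first by exists a.
  by split; [exists b|rewrite fmorph_eq0 fmorph_div].
by move/(_ fc h e)/eqP; rewrite fmorph_eq0 => /eqP.
Qed.

Variables (n : nat) (c : nat -> F -> Prop).
Hypotheses (c0 : c 0%N = zeroset) (cp : forall i, (i <= n)%N -> is_prime S (c i)).
Hypothesis (cs : forall i, (i < n)%N -> ssub (c i) (c i.+1)).

Let q i : K -> Prop := fun x => T x /\ c i (j x).
Let P i : K -> Prop := fun x => D x /\ c i (j x).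

Hypothesis qprimeT : forall i, (i <= n)%N -> (exists x, q i x /\ x != 0) -> qprime T st (q i).
Hypothesis quasi_prufer_at : forall i, (i <= n)%N -> (exists x, P i x /\ x != 0) ->
  forall Q : {poly K} -> Prop, is_prime (polyin D) Q -> subset Q (polyin (P i)) ->
    seteq Q (polyin (fun a => D a /\ Q a%:P)).

(* Going down the chain, an independent family modulo c i.+1 remains independent modulo c i,
   and gains one element whenever the contraction to D does not change. *)
Lemma chain_dimension i m (y : 'I_m -> F) : (i <= n)%N -> (forall k, S (y k)) ->
  indep_mod (image_of j D) (c i) y ->
  exists r m0, qchain T st (q i) r /\ (exists y0 : 'I_m0 -> F, alg_indep j y0) /\
    (i + m <= r + m0)%N.
Proof.
elim: i m y => [|i IH] m y ile Sy iy.
  exists 0%N, m; split.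
    apply: qchain_zero => x; rewrite /q c0; split; last by move=> ->; rewrite /zeroset rmorph0; split=> //; apply: subring0.
    by move=> [_ /eqP]; rewrite fmorph_eq0 => /eqP.
  by split=> //; exists y; apply: alg_indep_of_indep_mod; rewrite -c0.
have [ci pi pi1] : [/\ ssub (c i) (c i.+1), is_prime S (c i) & is_prime S (c i.+1)].
  by split; [apply: cs|apply: cp; apply: ltnW|apply: cp].
have [sub [u [cu nu]]] := ci.
have Su : S u by case: pi1 => iI _; apply: (ideal_sub iI).
have c00 k : (k <= n)%N -> q k 0.
  move=> kn; split; first exact: subring0.
  by rewrite rmorph0; case: (cp kn) => iI _; apply: (ideal0 iI).
have qsub : subset (q i) (q i.+1) by move=> x [Tx /sub].
have extend r : qchain T st (q i) r -> ssub (q i) (q i.+1) -> qchain T st (q i.+1) r.+1.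
  move=> ch ss; apply: (qchain_extend ch) => //; apply: qprimeT => //.
  by apply: ssub_nonzero ss; apply: c00; apply: ltnW.
(* If no new element of [D] enters, [u] joins the family and the sum is kept: i.+1 + m = i +
   m.+1. *)
have [PP|nPP] := pselect (forall a, D a -> c i.+1 (j a) -> c i (j a)).
  have [|||r [m0 [ch [ai le]]]] := IH m.+1 (vcons u y).
  - exact: ltnW.
  - by move=> k; rewrite /vcons; case: unlift.
  - apply: (indep_mod_cons sS pi pi1) => //; first by move=> _ [a Da ->]; apply: DS.
    by move=> _ [a Da ->]; apply: PP.
  (* The contraction to [T] may grow although the one to [D] does not; the chain in [T] is then one
     longer and the inequality is strict. *)
  have [qq|nqq] := pselect (subset (q i.+1) (q i)).
    exists r, m0; split; last by rewrite addSn -addnS.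
    by rewrite (_ : q i.+1 = q i) //; apply: seteq_eq => x; split; [apply: qq|apply: qsub].
  have ss : ssub (q i) (q i.+1).
    by split=> //; move/existsNP: nqq => [x /not_implyP]; exists x.
  exists r.+1, m0; split; first exact: extend.
  by split=> //; rewrite !addSn; apply: leq_trans (leqnSn _); rewrite -addnS.
(* A new element of [D] is also new in [T]: the chain in [T] gains a step while the family keeps its
   size. *)
move/existsNP: nPP => [a /not_implyP [Da /not_implyP [ca nca]]].
have ss : ssub (q i) (q i.+1).
  split=> //; exists a; split; first by split=> //; apply: DT.
  by move=> [].
have [||r [m0 [ch [ai le]]]] := IH m y _ Sy; first exact: ltnW.
  apply: (indep_mod_descent sD sS DS pi pi1 sub) => //; apply: quasi_prufer_at => //.
  exists a; split=> //; apply: contra_notN nca => /eqP ->; rewrite rmorph0.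
  by case: pi => iI _; apply: (ideal0 iI).
by exists r.+1, m0; split; [apply: extend|split=> //; rewrite !addSn ltnS].
Qed.

End DimensionInequality.

Lemma ssub_chain_mono (T : Type) (c : nat -> T -> Prop) n i :
  (forall i, (i < n)%N -> ssub (c i) (c i.+1)) -> (i <= n)%N -> subset (c i) (c n).
Proof.
elim: n => [|n IH] cs; first by rewrite leqn0 => /eqP ->.
rewrite leq_eqVlt => /orP [/eqP -> //|]; rewrite ltnS => ile x cx.
have [sub _] := cs n (ltnSn _); apply: sub; apply: IH cx => // k kn.
by apply: cs; apply: ltnW.
Qed.

(** A relation in no variables is a single constant. This provides a member of the set whose
    supremum is [trdeg_res]. *)
Lemma resid_indep0 (K F : fieldType) (j : {rmorphism K -> F}) (T : K -> Prop) (S Q : F -> Prop) :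
  is_subring T -> is_subring S -> (forall x, T x -> S (j x)) -> is_prime S Q ->
  exists y : 'I_0 -> F, resid_indep j T (fun x => T x /\ Q (j x)) S Q y.
Proof.
move=> sT sS TS pQ; exists (fun=> 0); split=> [[]//|d c Tc Qc e].
have pq := prime_preimage sT TS pQ.
have [a [b [Ta [Tb [nb ceE]]]]] := Tc e.
exists a, b; split=> //; split=> //.
move: Qc; rewrite /peval (bigD1 e) //= [X in _ + X]big1 => [|e']; last first.
  by have -> : e' = e by [apply/ffunP => -[]]; rewrite eqxx.
rewrite big_ord0 mulr1 addr0 ceE fmorph_div => Qab.
apply: (locid_contract pQ pQ (fun x h => h) (TS _ Ta)).
have nQb : ~ Q (j b) by move=> Qb; apply: nb.
rewrite -[j a](divfK (prime_neq0 pQ nQb)) mulrC.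
by apply: (idealM (locid_ideal sS pQ pQ.1)) => //; apply: locid_incl => //; apply: TS.
Qed.

Lemma dim_ineq_of_quasi_prufer (K F : fieldType) (j : {rmorphism K -> F}) (D T : K -> Prop)
  (S : F -> Prop) (st st' : (K -> Prop) -> (K -> Prop)) (st'' : (F -> Prop) -> (F -> Prop)) :
  is_domain D -> semistar D st -> quasi_prufer D (st_tilde D st) -> overring D T ->
  semistar T st' -> linked D st T st' -> is_domain S -> (forall x, T x -> S (j x)) ->
  dim_ineq T (st_tilde T st') j S (st_tilde S st'').
Proof.
move=> dD sst qp [sT DT] sst' lT [sS _] TS Q qQ q hq.
have [_ pQ] := qQ.
have pq : is_prime T q := prime_preimage sT TS pQ.
have [iq _] := pq; have iQ := pQ.1.
have sD : is_subring D by case: dD.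
have [y0 ry0] := resid_indep0 sT sS TS pQ.
apply: (ele_esup_add (qchain_single qQ)); first by exists y0.
move=> n m [c [/seteq_eq c0 [/seteq_eq cn [cq cs]]]] [y [Sy ry]].
have cp i : (i <= n)%N -> is_prime S (c i).
  case: i => [|i] ile; first by rewrite c0; apply: zeroset_prime.
  by case: (cq i.+1 ile).
have cQ i : (i <= n)%N -> subset (c i) Q by rewrite -cn => ile; apply: ssub_chain_mono.
(* The families of [resid_indep] lie in the localization of [S] at [Q], so the chain is moved there;
   contractions to [T] and [D] do not change. *)
pose c' i := locid S Q (c i).
have iS x : S x -> loc S Q x := @locid_incl _ _ _ sS pQ _ x.
have sS' := loc_subring sS pQ.
have contract i x : (i <= n)%N -> S x -> c' i x -> c i x.
  by move=> ile; apply: (locid_contract pQ (cp i ile) (cQ i ile)).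
have nz_sub i x : (i <= n)%N -> T x -> c' i (j x) -> q x.
  by move=> ile Tx /(contract i _ ile (TS _ Tx))/cQ Qx; split=> //; apply: Qx.
have TS' x : T x -> loc S Q (j x) by move/TS/iS.
have cp' i : (i <= n)%N -> is_prime (loc S Q) (c' i).
  by move=> ile; apply: locid_prime => //; [apply: cp|apply: cQ].
(* When [q] is nonzero, the side condition [hq] yields a quasi-maximal ideal of [T] above [q], hence
   above every contraction in the chain. *)
have in_qmax : (exists x, q x /\ x != 0) -> exists2 N, qmax T (star_f T st') N & subset q N.
  move=> [x [qx x0]]; case: hq => [/(_ x) [/(_ qx) xz _]|]; first by rewrite xz eqxx in x0.
  exact: sub_qmax_of_ssub.
have [|||||r [m0 [ch [ai le]]]] := @chain_dimension K F j D T (loc S Q) (st_tilde T st') dD DT sT sS'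
    TS' n c' _ cp' _ _ _ n m y (leqnn n) Sy.
- apply: seteq_eq => x; split=> [[a [b [az [_ [_ ->]]]]]|->].
    by move: az; rewrite c0 => ->; rewrite /zeroset mul0r.
  by apply: locid_incl => //; rewrite c0.
- move=> i il; have [sub [x [cx ncx]]] := cs i il; split; first by move=> z; apply: locid_mono.
  exists x; split; first exact: locid_incl.
  move/contract => h; apply: ncx; apply: h; first exact: ltnW.
  by case: (cp i.+1 il) => iI _; apply: (ideal_sub iI).
- move=> i ile [x [[Tx cx] x0]].
  have [|N qN qsN] := in_qmax; first by exists x; split=> //; apply: nz_sub cx.
  apply: (qprime_tilde_sub_qmax sT sst' qN).
  + exact: (prime_preimage sT TS' (cp' i ile)).
  + by exists x.
  + by move=> z [Tz cz]; apply: qsN; apply: nz_sub cz.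
- move=> i ile [x [[Dx cx] x0]] Q' pQ' Q'P.
  have Tx := DT _ Dx.
  have [|N qN qsN] := in_qmax; first by exists x; split=> //; apply: nz_sub cx.
  (* Linkedness places the contractions to [D] below the quasi-maximal [M]; the nonzero ones are
     then quasi-primes, to which [qp] applies. *)
  have [M qM PM] := linked_contract_qmax dD sT DT sst sst' lT qN.
  apply: qp => //; eexists; split; last exact: Q'P.
  apply: (qprime_tilde_sub_qmax sD sst qM).
  + by apply: (prime_preimage sD) (cp' i ile) => z /DT /TS'.
  + by exists x.
  + by move=> z [Dz cz]; apply: PM; split=> //; apply: qsN; apply: nz_sub cz => //; apply: DT.
- move=> d a Da; rewrite /c' cn => Qs e.
  have /choice [b bP] : forall e, exists b, D b /\ a e = j b by move=> e'; case: (Da e') => b; exists b.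
  have aE : a = (fun e => j (b e)) by apply/funext => e'; case: (bP e').
  have /(_ e) [u [v [qu [Tv [nv be]]]]] : forall e, locid T q q (b e).
    apply: ry; last by move: Qs; rewrite aE.
    by move=> e'; apply: locid_incl => //; apply: DT; case: (bP e').
  rewrite aE be fmorph_div; exists (j u), (j v); split; first by case: qu.
  by split; [apply: TS|split=> // Qv; apply: nv].
exists r, m0; split=> //.
rewrite (_ : q = (fun x => T x /\ c' n (j x))) //; apply: seteq_eq => x; split=> [[Tx Qx]|[Tx cx]].
  by split=> //; apply: locid_incl => //; rewrite cn.
exact: nz_sub cx.
Qed.

(** * Unextended primes *)

Lemma indep_mod_single (F : fieldType) (A : F -> Prop) (u : F) : is_subring A ->
  ~ algebraic_over A u -> indep_mod A zeroset (fun _ : 'I_1 => u).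
Proof.
move=> sA nu d c Ac; rewrite sum_monomials_cons => h e; apply: contrapT => ce0; apply: nu.
pose p := \poly_(k < d) (if insub k is Some k' then c (expcons k' (exptail e)) else 0).
have pE (k : 'I_d) : p`_k = c (expcons k (exptail e)) by rewrite coef_poly ltn_ord valK.
exists p; first by apply/eqP => p0; apply: ce0; rewrite -(expcons_eta e) -pE p0 coef0.
split.
  by move=> i; rewrite coef_poly; case: ltnP => id; [rewrite insubT|apply: subring0].
apply/rootP; rewrite horner_poly -[RHS]h; apply: eq_bigr => k _; rewrite valK mulrC.
rewrite (bigD1 (exptail e)) //= [X in _ + X]big1 ?addr0 => [|e']; last first.
  by have -> : e' = exptail e by [apply/ffunP => -[]]; rewrite eqxx.
by rewrite /monomial big_ord0 mulr1.
Qed.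

(** If the first coefficients of [f] and [g] outside [P] have indices i and k, their product is the
    only term of the coefficient i + k of [f * g] that is not already known to be in [P]. *)
Lemma polyin_prime (K : fieldType) (D P : K -> Prop) : is_subring D -> is_prime D P ->
  is_prime (polyin D) (polyin P).
Proof.
move=> sD [iP [P1 pP]]; split; first exact: polyin_ideal.
split; first by move/(_ 0%N); rewrite coef1.
move=> f g Df Dg Pfg.
have first_out (h : {poly K}) : ~ polyin P h -> exists i, ~ P h`_i /\ forall l, (l < i)%N -> P h`_l.
  move=> /existsNP ex; have ex' : exists i, `[<~ P h`_i>] by have [i hi] := ex; exists i; apply/asboolP.
  exists (ex_minn ex'); case: ex_minnP => i /asboolP ni imin; split=> // l li.
  by apply: contrapT => /asboolP /imin; rewrite leqNgt li.
apply: contrapT => /not_orP [/first_out [i [ni hi]] /first_out [k [nk hk]]].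
have := Pfg (i + k)%N; rewrite coefM (bigD1 (inord i)) //= inordK ?ltnS ?leq_addr // addKn.
rewrite addrC => h.
have /pP [||//|//] : P (f`_i * g`_k); [|exact: Df|exact: Dg].
apply: (ideal_addl sD iP) h; apply: (ideal_sum iP) => l; case: (ltngtP l i) => li lne.
- by rewrite mulrC; apply: (idealM iP) => //; apply: hi.
- apply: (idealM iP) => //; apply: hk.
  by rewrite ltn_subLR ?ltn_add2r // -ltnS.
- by case/eqP: lne; apply: val_inj; rewrite /= inordK // ltnS leq_addr.
Qed.

Section TranscendentalResidue.
Variables (K : fieldType) (D P : K -> Prop) (Q : {poly K} -> Prop).
Hypotheses (sD : is_subring D) (pP : is_prime D P) (pQ : is_prime (polyin D) Q).
Hypotheses (QP : subset Q (polyin P)).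

Lemma not_extended_prime : ~ seteq Q (polyin (fun a => D a /\ Q a%:P)) ->
  exists g i, Q g /\ ~ Q (g`_i)%:P.
Proof.
move=> nQ; apply: contrapT => ngi; apply: nQ => p; split.
  move=> Qp i; have [iQ _] := pQ; split; first exact: (ideal_sub iQ Qp).
  by apply: contrapT => nq; apply: ngi; exists p, i.
have [iQ _] := pQ.
move=> Dp; rewrite -[p]coefK poly_def; apply: (ideal_sum iQ) => i _.
rewrite -mul_polyC mulrC; apply: (idealM iQ); last by case: (Dp i).
by move=> l; rewrite coefXn; case: eqP => _; [apply: subring1|apply: subring0].
Qed.

(** Inside K(X), take the valuation pair attached to the primes [Q] and P[X] of D[X], localized at
    P[X]. Its ideal meets D[X] in P[X], so the residue of X is transcendental over [D]. Dividing [g]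
    by a coefficient of least value gives a polynomial with a coefficient 1 whose value at X has
    residue 0. If all residues of its coefficients were algebraic over [D], so would be that of X.
    Hence some coefficient, an element of [K], has transcendental residue, and [W] is the trace of
    [V] on [K]. *)
Lemma transcendental_residue g i0 : Q g -> ~ Q (g`_i0)%:P ->
  exists (W m : K -> Prop) (kappa : fieldType) (rho : K -> kappa) (w : K),
  [/\ is_subring W, is_ideal W m, ~ m 1 & forall x, W x -> ~ m x -> W x^-1] /\
  [/\ rho 1 = 1,
      forall x y, W x -> W y -> rho (x + y) = rho x + rho y,
      forall x y, W x -> W y -> rho (x * y) = rho x * rho y &
      forall x, W x -> rho x = 0 <-> m x] /\
  [/\ subset D W, forall a, D a -> m a <-> P a, W w &
      ~ algebraic_over (residue_image rho D) (rho w)].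
Proof.
move=> Qg nQi0.
pose F : fieldType := {fraction {poly K}}.
pose iota : {rmorphism {poly K} -> F} := @tofrac {poly K}.
pose j : {rmorphism K -> F} := iota \o polyC.
have iota_inj : injective iota.
  by move=> p q /eqP; rewrite -subr_eq0 -rmorphB tofrac_eq0 subr_eq0 => /eqP.
have iotaE (p : {poly K}) : iota p = (map_poly j p).[iota 'X].
  rewrite map_poly_comp horner_map; congr (iota _).
  by rewrite -[LHS]comp_polyXr.
have sP := polyin_subring sD.
have pPX := polyin_prime sD pP.
pose S0 := image_of iota (polyin D); pose Q0 := image_of iota Q; pose P0 := image_of iota (polyin P).
have sS0 : is_subring S0 := image_of_subring iota sP.
have pQ0 : is_prime S0 Q0 := image_of_prime iota_inj pQ.
have pP0 : is_prime S0 P0 := image_of_prime iota_inj pPX.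
have QP0 : subset Q0 P0 by move=> _ [p /QP Pp ->]; exists p.
have PP0 : subset P0 P0 by [].
have [V [I [kappa [rho [[sV iI I1 unitV] [[SV nI IQ prim] [rho1 rhoD rhoM rho_eq0]]]]]]] :=
  relative_valuation_residue (loc_subring sS0 pP0) (locid_prime sS0 pP0 pQ0 QP0)
    (locid_prime sS0 pP0 pP0 PP0) (fun x => @locid_mono _ S0 P0 Q0 P0 x QP0)
    (@locid_unit _ S0 P0).
have S0S x : S0 x -> loc S0 P0 x by apply: locid_incl.
have S0V x : S0 x -> V x by move/S0S/SV.
have IP p : polyin D p -> I (iota p) -> polyin P p.
  move=> Dp; have Sp : S0 (iota p) by exists p.
  move/(IQ _ (S0S _ Sp))/(locid_contract pP0 pP0 PP0 Sp) => -[q Pq /iota_inj ->]; exact: Pq.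
have Dcst a : D a -> polyin D a%:P.
  by move=> Da i; rewrite coefC; case: eqP => _ //; apply: subring0.
have S0j a : D a -> S0 (j a) by move=> Da; exists a%:P => //; apply: Dcst.
have [iQ _] := pQ; have Dg := ideal_sub iQ Qg.
have [iP _] := pP.
have mP a : D a -> I (j a) <-> P a.
  move=> Da; split; first by move/(IP _ (Dcst _ Da))/(_ 0%N); rewrite coefC.
  move=> Pa; apply/IQ; first by apply/S0S/S0j.
  apply: locid_incl => //; exists a%:P => // i.
  by rewrite coefC; case: eqP => _ //; apply: (ideal0 iP).
have VX : V (iota 'X).
  apply: S0V; exists 'X => // i.
  by rewrite coefX; case: eqP => _; [apply: subring1|apply: subring0].
have sA : is_subring (residue_image (rho \o j) D).
  have sjD := image_of_subring j sD.
  have [h0 [h1 [hB hM]]] : is_subring (residue_image rho (image_of j D)).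
    by apply: (residue_image_subring sV iI) => // _ [a Da ->]; apply/S0V/S0j.
  have E : residue_image rho (image_of j D) = residue_image (rho \o j) D.
    apply: seteq_eq => z; split; first by move=> [_ [a Da ->] ->]; exists a.
    by move=> [a Da ->]; exists (j a) => //; exists a.
  by rewrite -E.
(* An equation for the residue of X lifts to a polynomial over [D] in [I], hence in P[X], so all its
   coefficients reduce to 0. *)
have nX : ~ algebraic_over (residue_image (rho \o j) D) (rho (iota 'X)).
  move=> [p p0 [Ap /rootP px]].
  have /choice [a aP] : forall i, exists a, D a /\ p`_i = rho (j a).
    by move=> i; have [a] := Ap i; exists a.
  pose h := \poly_(i < size p) a i.
  have Dh : polyin D h.
    by move=> i; rewrite coef_poly; case: ifP => _; [case: (aP i)|apply: subring0].
  have Ih : I (iota h).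
    apply/rho_eq0; first by apply: S0V; exists h.
    rewrite -px iotaE (_ : map_poly j h = \poly_(i < size p) j (a i)); last first.
      by apply/polyP => i; rewrite coef_map !coef_poly; case: ifP => _ //; rewrite rmorph0.
    rewrite horner_poly (residue_sum sV iI rhoD rho_eq0) => [|i]; last first.
      apply: subringM => //; last exact: subringX.
      by apply/S0V/S0j; case: (aP i).
    rewrite horner_coef; apply: eq_bigr => i _; have [Da ->] := aP i.
    rewrite rhoM ?(residueX sV rho1 rhoM) //; last exact: subringX.
    exact/S0V/S0j.
  case/eqP: p0; apply/polyP => i; rewrite coef0; have [Da ->] := aP i.
  apply/rho_eq0; first exact/S0V/S0j.
  have := IP _ Dh Ih i; rewrite coef_poly; case: ltnP => [_ /(mP _ Da) //|ip _].
  apply/rho_eq0; first exact/S0V/S0j.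
  have [_ <-] := aP i; exact: nth_default.
have i0s : (i0 < size g)%N.
  rewrite ltnNge; apply/negP => h; apply: nQi0; rewrite nth_default //.
  exact: (ideal0 iQ).
have [|/=|i1 [ni1 Vi1]] := prim _ (fun i : 'I_(size g) => j g`_i) (Ordinal i0s).
- by move=> i; apply/S0S/S0j.
- move/(locid_contract pP0 pQ0 QP0 (S0j _ (Dg i0))) => [q Qq /iota_inj h].
  by apply: nQi0; rewrite h.
have pQ' := locid_prime sS0 pP0 pQ0 QP0.
have ji1 := prime_neq0 pQ' ni1.
have gi1 : g`_i1 != 0 by rewrite -(fmorph_eq0 j).
(* The coefficient of [h] at [i1] is 1, so the reduction of [h] is not the zero polynomial. *)
pose h := (g`_i1)^-1 *: g.
have hE i : h`_i = g`_i / g`_i1 by rewrite coefZ mulrC.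
have Vh i : V (j h`_i).
  rewrite hE fmorph_div; have [ig|ig] := ltnP i (size g); first exact: (Vi1 (Ordinal ig)).
  by rewrite nth_default // rmorph0 mul0r; apply: subring0.
have [i nalg] : exists i, ~ algebraic_over (residue_image (rho \o j) D) (rho (j h`_i)).
  apply: contrapT => allalg; apply: nX.
  pose r := \poly_(i < size (map_poly j h)) rho (map_poly j h)`_i.
  have rE i : r`_i = rho (j h`_i).
    rewrite coef_poly coef_map; case: ltnP => // hi.
    by rewrite -coef_map nth_default // (residue0 sV iI rho_eq0).
  apply: (@algebraic_over_root _ _ sA r).
  - apply/eqP => /polyP /(_ i1); rewrite rE hE divff // rmorph1 rho1 coef0 => /eqP.
    by rewrite oner_eq0.
  - apply/rootP; rewrite -(residue_horner sV iI) //; last by move=> i; rewrite coef_map; apply: Vh.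
    rewrite -iotaE; apply/rho_eq0.
      rewrite iotaE; apply: polyin_horner => // i; rewrite coef_map; exact: Vh.
    apply: nI; apply/(locidP pQ'); exists (j g`_i1).
    split; first exact/S0S/S0j.
    split=> //; have -> : j g`_i1 * iota h = iota g.
      change (iota (g`_i1)%:P * iota h = iota g).
      by rewrite -rmorphM mul_polyC /h scalerA divff // scale1r.
    by apply: locid_incl => //; exists g.
  - by move=> i; rewrite rE; apply: contrapT => nal; apply: allalg; exists i.
exists (fun x => V (j x)), (fun x => I (j x)), kappa, (rho \o j), h`_i.
split; [split|split; split] => //.
- split; first by rewrite rmorph0; apply: subring0.
  split; first by rewrite rmorph1; apply: subring1.
  by split=> x y Vx Vy; rewrite ?rmorphB ?rmorphM; [apply: subringB|apply: subringM].
- split; first by move=> x; apply: (ideal_sub iI).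
  split; first by rewrite rmorph0; apply: (ideal0 iI).
  by split=> x y Vx Vy; rewrite ?rmorphD ?rmorphM; [apply: (idealD iI)|apply: (idealM iI)].
- by move=> x Vx nx; rewrite fmorphV; apply: unitV.
- by move=> x y Vx Vy; change (rho (j (x + y)) = rho (j x) + rho (j y)); rewrite rmorphD; apply: rhoD.
- by move=> x y Vx Vy; change (rho (j (x * y)) = rho (j x) * rho (j y)); rewrite rmorphM; apply: rhoM.
- by move=> x Vx; apply: rho_eq0.
- by move=> a /S0j /S0V.
Qed.

End TranscendentalResidue.

(** * The ring D + m *)

Section Pullback.
Variables (K : fieldType) (D W m : K -> Prop) (kappa : fieldType) (rho : K -> kappa) (w : K).
Hypotheses (dD : is_domain D) (sW : is_subring W) (im : is_ideal W m) (m1 : ~ m 1).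
Hypothesis unitW : forall x, W x -> ~ m x -> W x^-1.
Hypotheses (rho1 : rho 1 = 1)
  (rhoD : forall x y, W x -> W y -> rho (x + y) = rho x + rho y)
  (rhoM : forall x y, W x -> W y -> rho (x * y) = rho x * rho y)
  (rho_eq0 : forall x, W x -> rho x = 0 <-> m x).
Hypotheses (DW : subset D W) (nzm : exists x, m x /\ x != 0).
Hypotheses (Ww : W w) (tw : ~ algebraic_over (residue_image rho D) (rho w)).

Let sD : is_subring D. Proof. by case: dD. Qed.

Lemma local_prime : is_prime W m.
Proof.
split=> //; split=> // a b Wa Wb mab; have [|na] := pselect (m a); [by left|right].
have a0 : a != 0 by apply/eqP => h; apply: na; rewrite h; apply: (ideal0 im).
by rewrite -(mulKf a0 b); apply: (idealM im) => //; apply: unitW.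
Qed.

(** This is the preimage in [W] of the image of [D] in W/m. Its residue field at [m] is the field of
    fractions of that image, over which the residue of [w] is transcendental. *)
Definition pullback : K -> Prop := fun x => exists a b, D a /\ m b /\ x = a + b.

Let T := pullback.

Lemma pullback_incl : subset D T.
Proof. by move=> a Da; exists a, 0; rewrite addr0; split=> //; split=> //; apply: (ideal0 im). Qed.

Lemma pullback_ideal_incl : subset m T.
Proof. by move=> b mb; exists 0, b; rewrite add0r; split=> //; apply: subring0. Qed.

Lemma pullback_sub : subset T W.
Proof. by move=> _ [a [b [Da [mb ->]]]]; apply: subringD => //; [apply: DW|apply: (ideal_sub im)]. Qed.

Lemma pullback_subring : is_subring T.
Proof.
split; first by apply: pullback_incl; apply: subring0.
split; first by apply: pullback_incl; apply: subring1.
split=> _ _ [a [b [Da [mb ->]]]] [c [e [Dc [me ->]]]].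
  exists (a - c), (b - e); split; first exact: subringB.
  by split; [apply: (idealB sW im)|rewrite opprD addrACA].
exists (a * c), (a * e + c * b + b * e); split; first exact: subringM.
split; last by ring.
apply: (idealD im); last by apply: (idealM im) => //; apply: (ideal_sub im).
by apply: (idealD im); apply: (idealM im) => //; apply: DW.
Qed.

Lemma domain_of_overring (A : K -> Prop) : is_subring A -> subset D A -> is_domain A.
Proof.
move=> sA DA; split=> // x; have [_ /(_ x) [a [b [Da [Db h]]]]] := dD.
by exists a, b; split; [apply: DA|split=> //; apply: DA].
Qed.

Lemma pullback_prime : is_prime T m.
Proof.
have [_ [_ pm]] := local_prime; split; [split|split] => //; first exact: pullback_ideal_incl.
  split; first exact: (ideal0 im).
  by split=> [x y|a x /pullback_sub Wa]; [apply: (idealD im)|apply: (idealM im)].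
by move=> a b /pullback_sub Wa /pullback_sub Wb; apply: pm.
Qed.

(* A prime of D + m strictly below m is an ideal of W: with z in m outside p, the products wz and wx lie
   in m, so z(wx) = (wz)x is in p and wx is in p. *)
Lemma pullback_prime_up p : is_prime T p -> ssub p m -> is_prime W p.
Proof.
move=> [ip [p1 pp]] [pm [z [mz nz]]].
have Tm : subset m T by apply: pullback_ideal_incl.
have iW : is_ideal W p.
  split; first by move=> x /pm; apply: (ideal_sub im).
  split; first exact: (ideal0 ip).
  split=> [x y|v x Wv px]; first exact: (idealD ip).
  have mvx : m (v * x) by apply: (idealM im) => //; apply: pm.
  have : p (z * (v * x)).
    rewrite mulrCA mulrA; apply: (idealM ip) => //.
    by apply/Tm/(idealM im).
  by case/pp => //; apply: Tm.
split=> //; split=> // a b Wa Wb pab.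
have : p ((a * z) * (b * z)).
  by rewrite (_ : _ * _ = (z * z) * (a * b)); [apply: (idealM iW) => //; apply: (subringM sW); apply: (ideal_sub im)|ring].
have half x : W x -> p (x * z) -> p x.
  move=> Wx pxz; have [mx|nx] := pselect (m x).
    by have [|||//|] := pp x z => //; apply: Tm.
  have x0 : x != 0 by apply/eqP => h; apply: nx; rewrite h; apply: (ideal0 im).
  by case: nz; rewrite -(mulKf x0 z); apply: (idealM iW) => //; apply: unitW.
by case/pp; [apply/Tm/(idealM im)|apply/Tm/(idealM im)|move/half; left|move/half; right]; auto.
Qed.

(** Members strictly below [m] are covered by [pullback_prime_up], and the last one is [m] itself.
    So [m] has at least the height in [W] that it has in D + m. *)
Lemma pullback_qchain_up n : qchain T (st_tilde T (locid T m)) m n ->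
  qchain W (st_tilde W (locid W m)) m n.
Proof.
move=> [c [c0 [/seteq_eq cn [cq cs]]]]; exists c; split=> //; split; first by rewrite cn.
split=> // -[//|i] /= iin.
have pW : is_prime W (c i.+1).
  have [ij|] := ltnP i.+1 n; last first.
    by move=> ni; have -> : i.+1 = n by [apply/eqP; rewrite eqn_leq iin]; rewrite cn; apply: local_prime.
  apply: pullback_prime_up; first by case: (cq i.+1 iin).
  have [sub [x [cx nx]]] := cs _ ij; rewrite -cn; split; first exact: ssub_chain_mono (ltnW ij).
  by exists x; split=> //; apply: (ssub_chain_mono cs ij).
apply: (qprime_tilde_sub_qmax sW (semistar_locid sW local_prime) (qmax_locid sW local_prime nzm)) => //.
  by have [_ [nz _]] := (cq i.+1 iin).1.
by rewrite -cn; apply: ssub_chain_mono.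
Qed.

Lemma pullback_resid_indep : resid_indep idfun T m W m (fun _ : 'I_1 => w).
Proof.
have pT := pullback_prime; have pW := local_prime.
split=> [_|d c Tc Qc]; first exact: locid_incl.
have [||||b [Tb nb] bP] := @common_denominator K _ c (fun x => T x /\ ~ m x) T.
- by split; [apply: (subring1 pullback_subring)|].
- move=> x y [Tx nx] [Ty ny]; split; first exact: (subringM pullback_subring).
  exact: (prime_complM pT).
- by move=> x y [Tx _] Ty; apply: (subringM pullback_subring).
- by move=> e; have /(locidP pT) [b [Tb [nb h]]] := Tc e; exists b.
(* Once denominators are cleared, each coefficient is in D + m and is replaced by its part in [D],
   which changes the relation only by an element of [m]. *)
have /choice [a aP] : forall e, exists a, D a /\ m (b * c e - a).
  by move=> e; have [a [l [Da [ml h]]]] := bP e; exists a; rewrite h addrC addKr.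
have Wm (e : {ffun 'I_1 -> 'I_d}) : W (monomial (fun=> w) e) by apply: monomial_in.
have Wa e : W (a e) by case: (aP e) => /DW.
have ms : m (\sum_e a e * monomial (fun=> w) e).
  have WS : W (b * peval idfun c (fun=> w)).
    rewrite /peval mulr_sumr; apply: subring_sum => // e _; rewrite mulrA; apply: (subringM sW); last exact: Wm.
    exact: (pullback_sub (bP e)).
  have : m (b * peval idfun c (fun=> w)).
    apply: (locid_contract pW pW (fun x h => h)) => //.
    apply: (idealM (locid_ideal sW pW im)) => //.
    by apply: locid_incl => //; apply: pullback_sub.
  rewrite -[\sum_e _](subrK (b * peval idfun c (fun=> w))) => mb; apply: (idealD im) => //.
  rewrite /peval mulr_sumr -sumrB; apply: (ideal_sum im) => e _.
  have [Da mba] := aP e.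
  rewrite (_ : _ - _ = monomial (fun=> w) e * - (b * c e - a e)); last by rewrite /monomial /=; ring.
  by apply: (idealM im) => //; apply: (idealN sW im).
have sA : is_subring (residue_image rho D) by apply: (residue_image_subring sW im).
have h := indep_mod_single sA tw.
have a0 e : m (a e).
  apply/rho_eq0 => //; apply: (h d (fun e => rho (a e))) => [e'|].
    by exists (a e') => //; case: (aP e').
  have E : rho (\sum_e a e * monomial (fun=> w) e) = 0.
    by apply/rho_eq0 => //; apply: subring_sum => // e' _; apply: (subringM sW).
  rewrite /zeroset -[RHS]E.
  rewrite (residue_sum sW im rhoD rho_eq0) => [|e']; last exact: subringM.
  by apply: eq_bigr => e' _; rewrite rhoM // (residue_monomial sW rho1 rhoM).
move=> e; apply/(locidP pT); exists b; split=> //; split=> //.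
by rewrite -[b * c e](subrK (a e)); apply: (idealD im) => //; case: (aP e).
Qed.

End Pullback.

Lemma trdeg_id (K : fieldType) : trdeg (idfun : {rmorphism K -> K}) = Some 0%N.
Proof.
rewrite /trdeg; have [|[|k] -> //] := @esup_some (fun m => exists y : 'I_m -> K, alg_indep idfun y) 0%N.
case=> // m [y iy].
have sK : is_subring (fun _ : K => True) by [].
have iy' : indep_mod (fun _ : K => True) zeroset y by move=> d c _; apply: iy.
case: (indep_mod_head sK iy'); exact: algebraic_over_incl.
Qed.

Lemma st_ht_finite (K : fieldType) (A P : K -> Prop) st : is_subring A -> st_dim A st <> None ->
  qprime A st P -> exists h, st_ht A st P = Some h.
Proof.
move=> sA; case E : (st_dim A st) => [d|] // _ qP.
rewrite /st_ht; have [n [c [c0 [cn [cq cs]]]]|h -> _] := @esup_some (qchain A st P) d; last by exists h.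
apply: (esup_ub E); exists P; split=> //; exists c; split=> //; split=> //; split=> // -[_|i ile].
  by rewrite (seteq_eq c0); apply: zeroset_prime.
by case: (cq i.+1 ile).
Qed.

Lemma quasi_prufer_of_dim_ineq (K : fieldType) (D : K -> Prop) st :
  is_domain D -> semistar D st -> st_dim D (st_tilde D st) <> None ->
  (forall T st', overring D T -> semistar T st' -> linked D st T st' ->
   forall (S : K -> Prop) st'', is_domain S -> subset T S -> semistar S st'' ->
     dim_ineq T (st_tilde T st') (idfun : {rmorphism K -> K}) S (st_tilde S st'')) ->
  quasi_prufer D (st_tilde D st).
Proof.
move=> dD sst fin ineq Q pQ [P [qP QP]].
have sD : is_subring D by case: dD.
have [_ pP] := qP; apply: contrapT => /(not_extended_prime sD pQ) [g [i0 [Qg nQ]]].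
have [W [m [kappa [rho [w [[sW im m1 unitW] [[rho1 rhoD rhoM rho_eq0] [DW mP Ww tw]]]]]]]] :=
  transcendental_residue sD pP pQ QP Qg nQ.
have nzm : exists x, m x /\ x != 0.
  have [[iP [[x [Px x0]] _]] _] := qP; exists x; split=> //.
  by apply/mP => //; apply: (ideal_sub iP).
have pW := local_prime im m1 unitW.
set T := pullback D m.
have sT : is_subring T := pullback_subring dD sW im DW.
have pT : is_prime T m := pullback_prime dD sW im m1 unitW DW.
have DT : subset D T by move=> x; apply: (pullback_incl im).
have TW : subset T W by move=> x; apply: (pullback_sub sW im DW).
have qT : qprime T (st_tilde T (locid T m)) m.
  by apply: (qprime_tilde_sub_qmax sT (semistar_locid sT pT) (qmax_locid sT pT nzm)).
have qW : qprime W (st_tilde W (locid W m)) m.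
  by apply: (qprime_tilde_sub_qmax sW (semistar_locid sW pW) (qmax_locid sW pW nzm)).
have mDP : (fun x => D x /\ m x) = P.
  apply: seteq_eq => x; split; first by case=> Dx /mP -/(_ Dx).
  by have [iP _] := pP => Px; have Dx := ideal_sub iP Px; split=> //; apply/mP.
have mTm : (fun x => T x /\ m x) = m.
  apply: seteq_eq => x; split; first by case.
  by move=> mx; split=> //; apply: (pullback_ideal_incl dD).
have ssub_tilde A st0 q : is_subring A -> qprime A st0 q -> subset (st0 q) (st0 A) ->
    st0 A 1 -> ssub (st0 q) (st0 A).
  move=> sA [[iq [_ h]] [_ [q1 _]]] sub A1; split=> //; exists 1; split=> // sq1.
  by apply: q1; apply/h; split=> //; apply: subring1.
have tilde1 A st0 : is_subring A -> st_tilde A st0 A 1.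
  move=> sA M [_ [M1 _]]; exists 1, 1; rewrite divr1.
  by split; [apply: subring1|split; [apply: subring1|]].
have tilde_sub A st0 q : is_ideal A q -> subset (st_tilde A st0 q) (st_tilde A st0 A).
  by move=> iq x h M qM; apply: locid_mono (h M qM) => y; apply: (ideal_sub iq).
have [h0 hP] := st_ht_finite sD fin qP.
have lD : linked D st D st.
  move=> G fG _ stG; rewrite (_ : gen D G = G) //; apply: seteq_eq => x.
  have [_ [G0 [GD GM]]] := fgfrac_submod sD fG.
  by split; [apply: gen_min|apply: gen_incl].
have ssD : ssub (st_tilde D st P) (st_tilde D st D).
  by apply: ssub_tilde => //; [apply: tilde_sub; case: pP|apply: tilde1].
(* In the inequality for [D] in [T] the right-hand side is the height of [P], finite by the
   hypothesis on the dimension, plus a transcendence degree 0. Finiteness of [h] is what makes h + 1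
   <= h absurd at the end. *)
have [h hT] : exists h, st_ht T (st_tilde T (locid T m)) m = Some h.
  have := ineq D st (conj sD (fun x h => h)) sst lD T (locid T m)
    (domain_of_overring dD sT DT) DT (semistar_locid sT pT) m qT.
  rewrite /= mDP hP trdeg_id => /(_ (or_intror ssD)).
  case: (st_ht T _ m) => [h _|]; first by exists h.
  by case: (trdeg_res _ _ _ _ _).
have [M qM PM] := sub_qmax_of_qprime_tilde sD sst qP.
have lT : linked D st T (locid T m).
  by apply: (linked_locid sT pT sst sD DT qM); rewrite mDP.
have := ineq T (locid T m) (conj sT DT) (semistar_locid sT pT) lT W (locid W m)
  (domain_of_overring dD sW DW) TW (semistar_locid sW pW) m qW.
have ssT : ssub (st_tilde T (locid T m) m) (st_tilde T (locid T m) T).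
  by apply: ssub_tilde => //; [apply: tilde_sub; case: qT => -[]|apply: tilde1].
rewrite /= mTm hT trdeg_id => /(_ (or_intror ssT)) /=.
(* A finite height is attained, so there is a chain of length exactly [h] in [T] to carry up to
   [W]. *)
have chW := pullback_qchain_up dD sW im m1 unitW nzm (esup_attained hT (qchain_single qT)).
have riW : exists y : 'I_1 -> K, resid_indep idfun T m W m y.
  by exists (fun=> w); apply: (pullback_resid_indep dD sW im m1 unitW rho1 rhoD rhoM rho_eq0 DW).
(* The right-hand side is finite, so both summands on the left are; the height is at least [h] and
   the residual transcendence degree at least 1. *)
case hW: (st_ht W _ m) => [a|] //; case tW: (trdeg_res _ _ _ _ _) => [b|] //=.
rewrite addn0 => le; have ha := esup_ub hW chW; have b1 := esup_ub tW riW.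
by have := leq_trans (leq_add ha b1) le; rewrite addn1 ltnn.
Qed.

Theorem theorem3p3 (K : fieldType) (D : K -> Prop) (st : (K -> Prop) -> (K -> Prop)) :
  is_domain D -> semistar D st -> st_dim D (st_tilde D st) <> None ->
  (quasi_prufer D (st_tilde D st) <->
   forall (T : K -> Prop) (st' : (K -> Prop) -> (K -> Prop)),
     overring D T -> semistar T st' -> linked D st T st' ->
     forall (F : fieldType) (S : F -> Prop) (j : {rmorphism K -> F}),
       is_domain S -> (forall x, T x -> S (j x)) ->
       forall st'' : (F -> Prop) -> (F -> Prop), semistar S st'' ->
         dim_ineq T (st_tilde T st') j S (st_tilde S st'')).
Proof.
move=> dD sst fin; split.
  move=> qp T st' oT sst' lT F S j dS TS st'' _.
  exact: (dim_ineq_of_quasi_prufer dD sst qp oT sst' lT dS TS).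
move=> ineq; apply: (quasi_prufer_of_dim_ineq dD sst fin).
by move=> T st' oT sst' lT S st'' dS TS sst''; apply: (ineq T st').
Qed.
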